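(* For each $k\in\{4,5,6\}$ there exists an infinite class of triconnected embedded $k$-planar graphs (containing graphs with arbitrarily many vertices) such that, for every graph $G$ in the class, with $n$ denoting its number of vertices, every planar octilinear drawing of $G$ that respects the given embedding of $G$ has in total at least (i) $n/3-1$ bends, if $k=4$; (ii) $2n/3-2$ bends, if $k=5$; (iii) $4n/3-6$ bends, if $k=6$.
   Context: Graphs are finite, simple and undirected. A graph is $k$-planar if it is planar and has maximum degree $k$ (every vertex has degree at most $k$); this is unrelated to the notion of ''at most $k$ crossings per edge''. Triconnected means $3$-vertex-connected. An embedded planar graph is a planar graph together with a fixed combinatorial planar embedding, including the choice of the outer (unbounded) face; a planar drawing respects the embedding if it induces this embedding with this outer face. An octilinear drawing of a graph $G=(V,E)$ places the vertices at distinct points of the integer grid and draws each edge as a polygonal curve joining its endpoints and consisting of horizontal, vertical and diagonal (at $45^\circ$, i.e. slope $+1$ or $-1$) line segments. The drawing is planar if no two edges intersect except at common endpoints (and no edge passes through a vertex other than its endpoints). A bend is an interior point of an edge at which two consecutive segments of different directions meet; the number of bends of a drawing is the total over all edges. *)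

(* Defs.v *)
From HB Require Import structures.
From mathcomp Require Import all_boot all_order all_algebra all_fingroup.
From mathcomp Require Import all_classical all_reals all_analysis.

Set Implicit Arguments.
Unset Strict Implicit.
Unset Printing Implicit Defensive.

Import Order.TTheory GRing.Theory Num.Theory.
Import numFieldNormedType.Exports.

Local Open Scope classical_set_scope.
Local Open Scope ring_scope.

Record sgraph := SGraph {
  vertex :> finType;
  edge : rel vertex;
  edge_sym : symmetric edge;
  edge_irr : irreflexive edge }.

Definition max_degree_le (k : nat) (G : sgraph) : Prop :=
  forall v : G, (#|[set u | edge v u]%SET| <= k)%N.

Definition triconnected (G : sgraph) : Prop :=
  (3 < #|G|)%N /\
  forall S : {set G}, (#|S| < 3)%N -> forall u v : G, u \notin S -> v \notin S ->
    connect [rel x y | [&& edge x y, x \notin S & y \notin S]] u v.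

(* A dart (u, v) is the edge uv traversed from u to v.  If rot v sends each
   neighbour of v to the next one counterclockwise around v, face_next goes
   along the boundary of the face lying to the left of the darts. *)
Definition face_next (V : finType) (rot : V -> {perm V}) (d : V * V) : V * V :=
  (d.2, ((rot d.2)^-1)%g d.1).

Definition face_of (V : finType) (rot : V -> {perm V}) (d : V * V)
  : {set V * V} := [set d' | fconnect (face_next rot) d d']%SET.

(* A graph with a rotation system (rot v cyclically permutes the neighbours of
   v; its values elsewhere are irrelevant) and a distinguished face, given as a
   set of darts.  Planarity of this embedding is planar_embedding below. *)
Record embedded_graph := EmbeddedGraph {
  graph_of :> sgraph;
  rot : graph_of -> {perm graph_of};
  rotP : forall v u : graph_of, edge v u ->
    porbit (rot v) u = [set w | edge v w]%SET;
  outer : {set graph_of * graph_of};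
  outerP : exists2 d : graph_of * graph_of,
    edge d.1 d.2 & outer = face_of rot d }.

Section Plane.
Variable R : realType.
Local Notation plane := (R * R)%type.
Implicit Types (a b c p : plane) (s : seq plane).

Definition cross a b : R := a.1 * b.2 - a.2 * b.1.
Definition dot a b : R := a.1 * b.1 + a.2 * b.2.

Definition segment a b : set plane :=
  [set (1 - t) *: a + t *: b | t in [set t : R | 0 <= t <= 1]].

Definition same_direction a b : bool := (cross a b == 0) && (0 < dot a b).

(* The directions of the nonzero vectors a, b, c are pairwise distinct and occur
   in this cyclic order counterclockwise: each of the three successive
   counterclockwise angles lies in ]0, 2 pi[ and they sum to 2 pi, which happens
   exactly when at least two of them are less than pi. *)
Definition ccw a b c : bool :=
  [|| (0 < cross a b) && (0 < cross b c),
      (0 < cross b c) && (0 < cross c a)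
    | (0 < cross c a) && (0 < cross a b)].

Definition polyline s : set plane :=
  [set p | exists2 i : nat, (i.+1 < size s)%N & segment s`_i s`_i.+1 p].

Definition simple_polyline s : Prop :=
  (forall i, (i.+1 < size s)%N -> s`_i != s`_i.+1) /\
  (forall i j p, (i < j)%N -> (j.+1 < size s)%N ->
    segment s`_i s`_i.+1 p -> segment s`_j s`_j.+1 p ->
    j = i.+1 /\ p = s`_j).

Definition octilinear_vector a : bool :=
  [|| a.1 == 0, a.2 == 0, a.1 == a.2 | a.1 == - a.2].

(* Corners at which the direction does not change are not bends. *)
Definition polyline_bends s : nat :=
  \sum_(i < (size s).-2)
    ~~ same_direction (s`_i.+1 - s`_i)%R (s`_i.+2 - s`_i.+1)%R.

(* corners u v lists the corners of the edge uv strictly between its endpoints,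
   from u to v; it is irrelevant when u and v are not adjacent. *)
Record drawing (G : sgraph) := Drawing {
  pos : G -> plane;
  corners : G -> G -> seq plane;
  pos_inj : injective pos;
  corners_sym : forall u v : G, edge u v -> corners v u = rev (corners u v) }.

Section Drawing.
Variables (G : sgraph) (D : drawing G).

Definition edge_points (u v : G) : seq plane :=
  pos D u :: rcons (corners D u v) (pos D v).

Definition edge_curve (u v : G) : set plane := polyline (edge_points u v).

Definition planar_drawing : Prop :=
  [/\ forall u v, edge u v -> simple_polyline (edge_points u v),
      forall u v w, edge u v -> edge_curve u v (pos D w) -> w = u \/ w = v
    & forall u v x y p, edge u v -> edge x y -> [set u; v]%SET != [set x; y]%SET ->
        edge_curve u v p -> edge_curve x y p ->
        exists w, [/\ w \in [set u; v]%SET, w \in [set x; y]%SET & p = pos D w]].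

Definition octilinear_drawing : Prop :=
  (forall v, exists m n : int, pos D v = (m%:~R, n%:~R)) /\
  (forall u v i, edge u v -> (i.+1 < size (edge_points u v))%N ->
    octilinear_vector ((edge_points u v)`_i.+1 - (edge_points u v)`_i)).

Definition bends : nat :=
  \sum_(d : G * G | edge d.1 d.2 && (enum_rank d.1 < enum_rank d.2)%N)
    polyline_bends (edge_points d.1 d.2).

Definition drawn_set : set plane :=
  [set p | (exists v, p = pos D v) \/
           (exists u v, edge u v /\ edge_curve u v p)].

Definition unbounded_region : set plane :=
  [set p | ~ drawn_set p /\
           ~ bounded_set (connected_component (~` drawn_set) p)].

Definition first_corner (u v : G) : plane := (edge_points u v)`_1.

Definition initial_direction (u v : G) : plane := first_corner u v - pos D u.

(* The points just to the left of the midpoint of the first segment of the dart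
   (u, v) belong to the unbounded region. *)
Definition unbounded_on_left (u v : G) : Prop :=
  let a := pos D u in
  let d := initial_direction u v in
  \forall eps \near (0 : R)^'+,
    unbounded_region (a + 2^-1 *: d + eps *: (- d.2, d.1)).

End Drawing.

(* The graphs considered are connected, so that the boundary of the unbounded
   region is a single face of the rotation system. *)
Definition respects_embedding (G : embedded_graph) (D : drawing G) : Prop :=
  (forall v u w : G, edge v u -> edge v w ->
    ~~ ccw (initial_direction D v u) (initial_direction D v w)
           (initial_direction D v (rot v u))) /\
  (forall u v : G, edge u v -> ((u, v) \in outer G <-> unbounded_on_left D u v)).

(* Every planar embedding is realised by a polygonal drawing. *)
Definition planar_embedding (G : embedded_graph) : Prop :=
  exists D : drawing G, planar_drawing D /\ respects_embedding D.

End Plane.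

(* Main.v *)
(* The graphs are nested triangles, consecutive ones being joined by three spokes
   and, possibly, three diagonals: never for k = 4, in every other annulus for
   k = 5, always for k = 6.

   Angles of an octilinear drawing are multiples of pi/4; call pi/4 one unit.  A
   triangle of the graph is drawn as a simple closed polygon, whose turning is 8
   units (Hopf's Umlaufsatz; that it is traversed counterclockwise follows from
   the embedding, since the outside has winding number 0).  A vertex with d edges
   inside the polygon turns by at most 3 - d units, and a bend by at most 3.
   Hence the edges of a nested triangle turn by at least 8 - 3 * 2 = 2 units in
   total if the annulus inside it has no diagonals, and by at least 8 - 3 * 1 = 5
   if it has.  When the annulus outside has diagonals, each edge of the triangle
   also bounds a triangular face outside it, in which it turns the opposite way,
   by -t; as the corners of this face turn by at most 3 units each, its spoke and
   its diagonal must turn by at least 8 - 9 + t = t - 1.  So the triangle together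
   with the spokes and diagonals going outward from it has at least 1 bend if both
   annuli lack diagonals, 2 if exactly one has them, and 4 if both do. *)

Require Import Defs.
From HB Require Import structures.
From mathcomp Require Import all_boot all_order all_algebra all_fingroup.
From mathcomp Require Import all_classical all_reals all_analysis.
From mathcomp Require Import zify ring lra.

Set Implicit Arguments.
Unset Strict Implicit.
Unset Printing Implicit Defensive.

Import Order.TTheory GRing.Theory Num.Theory.
Import numFieldNormedType.Exports.

Local Open Scope ring_scope.

(** * Turning of closed polygons *)

Section HalfTurns.
Variable R : realType.
Local Notation plane := (R * R)%type.
Implicit Types (a b c d w x y : plane).

(** No angle is measured. A turn is encoded by an integer, the number of times the line spanned by
    the turning vector becomes horizontal. This count is additive inside any open half-plane, so
    homotopies become finite sums over cells, each kept in one half-plane by separating two disjoint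
    segments. A full turn counts 2; for octilinear vectors each count is worth 4 units, and the
    headings modulo 4 supply the rest. The obstacle is orientation: only the rotations and the outer
    face are prescribed, and that a triangle turns by +8 units rather than -8 has to be derived.
    Hopf's homotopy reduces the turning of a polygon to what is seen from one of its corners, and
    there an edge leading to a point of winding number 0 decides the sign. Such points come from the
    outer face: the winding number does not change along edges that avoid the polygon, hence it
    vanishes on a column of spokes followed inward. Origin of the constants: of the L = n/3
    triangles the innermost is not counted, having no edges inside, and the outermost has no annulus
    outside. The totals are L - 1, 2(L - 1) and 4(L - 2) + 2. *)

Definition upper a : bool := (0 < a.2) || ((a.2 == 0) && (0 < a.1)).

(* The signed number of times that the line through the origin spanned by a
   vector turning from a to b through an angle less than pi becomes
   horizontal, counted counterclockwise; the value 0 for opposite vectors is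
   arbitrary. *)
Definition half_turns a b : int :=
  if upper a == upper b then 0
  else if 0 < cross a b then 1 else if cross a b < 0 then -1 else 0.

Lemma upperN a : a != 0 -> upper (- a) = ~~ upper a.
Proof.
case: a => a1 a2; rewrite /upper /= xpair_eqE !oppr_gt0 oppr_eq0.
by case: (ltgtP a2 0) => //= _; case: ltgtP.
Qed.

Lemma crossNN a b : cross (- a) (- b) = cross a b.
Proof. by rewrite /cross /=; ring. Qed.

Lemma crossN a b : cross b a = - cross a b.
Proof. by rewrite /cross; ring. Qed.

Lemma half_turnsNN a b : a != 0 -> b != 0 ->
  half_turns (- a) (- b) = half_turns a b.
Proof.
by move=> a0 b0; rewrite /half_turns !upperN // crossNN; case: upper; case: upper.
Qed.

Lemma half_turns_sym a b : half_turns b a = - half_turns a b.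
Proof.
rewrite /half_turns eq_sym crossN; case: eqP => // _.
by rewrite oppr_gt0 oppr_lt0; case: ltgtP.
Qed.

(** An open half-plane meets the horizontal axis in at most one open ray, so whether it is crossed
    is read off from [upper]; the sign of [w.1] tells which of the two rays it is and hence the
    sense of the crossing. *)
Lemma half_turns_half_plane w a b : 0 < dot w a -> 0 < dot w b ->
  half_turns a b = (if 0 < w.1 then 1 else -1) * ((upper b)%:Z - (upper a)%:Z).
Proof.
have key (u v : plane) : 0 < dot w u -> 0 < dot w v -> upper u -> ~~ upper v ->
    if 0 < w.1 then cross u v < 0 else 0 < cross u v.
  case: w u v => [w1 w2] [a1 a2] [b1 b2]; rewrite /dot /cross /upper /=.
  case: (ltgtP a2 0) (ltgtP b2 0) => // ha [] //= hb; do ?move->;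
    rewrite ?mul0r ?mulr0 ?addr0 ?subr0 ?sub0r //; case: (ltP 0 w1) => hw; nra.
move=> wa wb; rewrite /half_turns.
case ua: (upper a); case ub: (upper b) => //=; rewrite ?mulr0 //.
  by have := key a b wa wb ua (negbT ub); case: ifP => _ h; rewrite ?h ?(lt_gtF h).
have := key b a wb wa ub (negbT ua); rewrite crossN oppr_lt0 oppr_gt0.
by case: ifP => _ h; rewrite ?h ?(lt_gtF h).
Qed.

(** Within an open half-plane the count is a difference of values of one function, hence
    additive. *)
Lemma half_turnsD w a b c : 0 < dot w a -> 0 < dot w b -> 0 < dot w c ->
  half_turns a b + half_turns b c = half_turns a c.
Proof.
by move=> wa wb wc; rewrite !(@half_turns_half_plane w) // -mulrDr; congr (_ * _); lia.
Qed.

(** One cell of a homotopy: while [x] moves to [x'] and [y] to [y'], the direction from the first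
    point to the second stays in a half-plane, so both ways around the cell count the same. *)
Lemma half_turns_cell w x x' y y' :
    0 < dot w (y - x) -> 0 < dot w (y' - x) ->
    0 < dot w (y - x') -> 0 < dot w (y' - x') ->
  half_turns (y - x) (y' - x) + half_turns (y' - x) (y' - x') =
  half_turns (y - x) (y - x') + half_turns (y - x') (y' - x').
Proof. by move=> *; rewrite !(@half_turnsD w). Qed.

Lemma dot_gt0 a : a != 0 -> 0 < dot a a.
Proof.
case: a => a1 a2; rewrite xpair_eqE negb_and /dot /= -!expr2.
by case/orP => h; [apply: ltr_pwDl|apply: ltr_wpDl];
  rewrite ?sqr_ge0 ?exprn_even_gt0.
Qed.

Lemma acute_half_plane a b : a != 0 -> b != 0 ->
    ~ (cross a b = 0 /\ dot a b < 0) ->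
  exists w, 0 < dot w a /\ 0 < dot w b.
Proof.
move=> a0 b0 nab; have [cab|cab] := eqVneq (cross a b) 0.
  exists a; split; first exact: dot_gt0.
  rewrite lt0r leNgt; apply/andP; split; last by apply/negP => h; apply: nab.
  apply/eqP => dab; have := mulr_gt0 (dot_gt0 a0) (dot_gt0 b0).
  have -> : dot a a * dot b b = dot a b ^+ 2 + cross a b ^+ 2.
    by rewrite /dot /cross; ring.
  by rewrite dab cab expr0n /= addr0 ltxx.
(* A normal to the line through the tips of [a] and [b], scaled so that its product with either
   vector is [cross a b ^+ 2]. *)
exists (cross a b * (b.2 - a.2), cross a b * (a.1 - b.1)).
have c2 : 0 < cross a b ^+ 2 by rewrite exprn_even_gt0.
by split; rewrite (_ : dot _ _ = cross a b ^+ 2) // /dot /cross /=; ring.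
Qed.
End HalfTurns.

(** * Separation of disjoint segments *)

Section Separation.
Variable R : realType.
Local Notation plane := (R * R)%type.
Implicit Types (a b c d w x y q : plane).
Local Open Scope classical_set_scope.

(** By convexity, the linear form given by [w] is then larger at every point of the segment from [y]
    to [y'] than at any point of the segment from [x] to [x']. *)
Definition separates w x x' y y' : bool :=
  [&& 0 < dot w (y - x), 0 < dot w (y' - x),
      0 < dot w (y - x') & 0 < dot w (y' - x')].

Lemma segmentP a b q : segment a b q <->
  exists t : R, [/\ 0 <= t, t <= 1 &
    q = (a.1 + t * (b.1 - a.1), a.2 + t * (b.2 - a.2))].
Proof.
case: a b => [a1 a2] [b1 b2]; split=> [[t /= /andP[t0 t1] <-]|[t [t0 t1 ->]]].
  by exists t; split=> //=; congr pair => /=; rewrite /GRing.scale /=; ring.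
by exists t; rewrite /= ?t0 //; congr pair => /=; rewrite /GRing.scale /=; ring.
Qed.

Lemma segmentl a b : segment a b a.
Proof.
by apply/segmentP; exists 0; split; rewrite ?ler01 // !mul0r !addr0; case: a.
Qed.

Lemma segment_sym a b : segment a b = segment b a.
Proof.
apply/seteqP; split=> q /segmentP[t [t0 t1 ->]]; apply/segmentP;
  exists (1 - t); (split; first by rewrite subr_ge0); rewrite ?lerBlDr ?lerDl //;
  congr pair; ring.
Qed.

Lemma segmentr a b : segment a b b.
Proof. by rewrite segment_sym; exact: segmentl. Qed.

(** The first-order condition at a minimum of a quadratic function on the unit interval. *)
Lemma nonneg_slope (d q : R) : 0 <= q ->
  (forall l : R, 0 <= l -> l <= 1 -> 0 <= 2 * l * d + l ^+ 2 * q) -> 0 <= d.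
Proof.
move=> q0 h; rewrite leNgt; apply/negP => d0.
have qd : 0 < q - d by rewrite subr_gt0 (lt_le_trans d0).
(* This [l] satisfies [l * q = l * d - d], which makes the quadratic equal to [l * d * (1 + l)], a
   negative number. *)
have l0 : 0 < - d / (q - d) by rewrite divr_gt0 // oppr_gt0.
have := h (- d / (q - d)) (ltW l0).
rewrite ler_pdivrMr // mul1r lerBrDl subrr => /(_ q0).
set l := _ / _ in l0 *; have e : l * (q - d) = - d by rewrite divfK // gt_eqF.
rewrite (_ : _ + _ = l * (d + l * d)); last by rewrite expr2 -mulrA; nra.
by rewrite pmulr_rge0 //; nra.
Qed.

(** The witness is the shortest vector from the first segment to the second, which exists by
    compactness of the square of parameters. By the first-order condition its product with any other
    such vector is at least its own squared length. *)
Lemma disjoint_segments_separated x x' y y' :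
  (forall q, segment x x' q -> segment y y' q -> False) ->
  exists w, separates w x x' y y'.
Proof.
move=> disj.
pose v (s t : R) : plane := (y.1 + t * (y'.1 - y.1) - (x.1 + s * (x'.1 - x.1)),
   y.2 + t * (y'.2 - y.2) - (x.2 + s * (x'.2 - x.2))).
pose f (st : R * R) := dot (v st.1 st.2) (v st.1 st.2).
pose I := `[(0 : R), 1]%classic.
have [|||[s0 t0] st0 fmin] := @compact_EVT_min _ R f (I `*` I).
- by exists (0, 0); split; rewrite /I /= in_itv /= lexx ler01.
- by apply: compact_setX; apply: segment_compact.
- apply: continuous_subspaceT => st; rewrite /f /v /dot /=.
  have c1 : (fun z : R * R => z.1) @ st --> st.1 by exact: cvg_fst.
  have c2 : (fun z : R * R => z.2) @ st --> st.2 by exact: cvg_snd.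
  have aff (A B C D : R) :
      (fun z : R * R => A + z.2 * B - (C + z.1 * D)) @ st
       --> A + st.2 * B - (C + st.1 * D).
    apply: cvgB; apply: cvgD; first exact: cvg_cst; last first.
    - by apply: cvgM => //; exact: cvg_cst.
    - exact: cvg_cst.
    - by apply: cvgM => //; exact: cvg_cst.
  by apply: cvgD; apply: cvgM; exact: aff.
move: st0; rewrite inE => -[]; rewrite /I /= !in_itv /= => /andP[s00 s01] /andP[t00 t01].
pose w := v s0 t0; exists w.
have w0 : 0 < dot w w.
  apply: dot_gt0; apply/eqP => w0.
  apply: (disj (x.1 + s0 * (x'.1 - x.1), x.2 + s0 * (x'.2 - x.2))).
    by apply/segmentP; exists s0.
  apply/segmentP; exists t0; split=> //.
  by move: w0 => [/eqP + /eqP]; rewrite !subr_eq0 => /eqP -> /eqP ->.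
have key (s t : R) : 0 <= s <= 1 -> 0 <= t <= 1 -> 0 < dot w (v s t).
  move=> /andP[sa sb] /andP[ta tb].
  have -> : dot w (v s t) = dot w w + dot w (v s t - w) by rewrite /dot /=; ring.
  apply: ltr_wpDr => //.
  apply: (@nonneg_slope _ (dot (v s t - w) (v s t - w))).
    by rewrite /dot -!expr2 addr_ge0 // sqr_ge0.
  move=> l l0 l1.
  have := fmin (s0 + l * (s - s0), t0 + l * (t - t0)).
  rewrite inE /I /= !in_itv /= => H.
  have {}H : f (s0, t0) <= f (s0 + l * (s - s0), t0 + l * (t - t0)).
    by apply: H; split; apply/andP; split; nra.
  move: H; rewrite -subr_ge0; congr (0 <= _).
  by rewrite /f /w /dot /v /=; ring.
have z : 0 <= (0 : R) <= 1 by rewrite lexx ler01.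
have o : 0 <= (1 : R) <= 1 by rewrite ler01 lexx.
have corner a b (s t : R) : 0 <= s <= 1 -> 0 <= t <= 1 -> v s t = b - a ->
    0 < dot w (b - a) by move=> hs ht <-; exact: key.
apply/and4P; split; [apply: (corner _ _ 0 0)|apply: (corner _ _ 0 1)|
  apply: (corner _ _ 1 0)|apply: (corner _ _ 1 1)] => //;
  by rewrite [RHS]surjective_pairing /v; congr pair => /=; ring.
Qed.

End Separation.

(** * Hopf's homotopy for simple closed polygons *)

Section Turning.
Variable R : realType.
Local Notation plane := (R * R)%type.
Implicit Types (a b c d w x y q : plane) (p : nat -> plane).
Local Open Scope classical_set_scope.

(** The half turns made by the ray from [x] to a point running along [p 0], ..., [p n]. For a closed
    path that avoids [x] this is twice the winding number around [x]. *)
Definition fan p n x : int :=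
  \sum_(i < n) half_turns (p i - x) (p i.+1 - x).

Definition simple_closed p m : Prop :=
  [/\ p m = p 0%N, forall i, (i < m)%N -> p i != p i.+1
    & forall i j q, (i < j)%N -> (j < m)%N ->
        segment (p i) (p i.+1) q -> segment (p j) (p j.+1) q ->
        (j = i.+1 /\ q = p j) \/ [/\ i = 0%N, j.+1 = m & q = p 0%N]].

(** Counted in half turns, so that a counterclockwise simple polygon has turning 2; the last term is
    the turn at the corner where the polygon closes. *)
Definition turning p m : int :=
  \sum_(i < m.-1) half_turns (p i.+1 - p i) (p i.+2 - p i.+1)
  + half_turns (p m - p m.-1) (p 1%N - p 0%N).

Lemma fanS p n x :
  fan p n.+1 x = fan p n x + half_turns (p n - x) (p n.+1 - x).
Proof. by rewrite /fan big_ord_recr. Qed.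

(** The cells along the path are added up; what neighbouring cells share cancels, and only the
    contributions of the two ends of the path remain. *)
Lemma fan_shift p n x x' :
    (forall i, (i < n)%N -> exists w, separates w x x' (p i) (p i.+1)) ->
  fan p n x + half_turns (p n - x) (p n - x') =
  half_turns (p 0%N - x) (p 0%N - x') + fan p n x'.
Proof.
elim: n => [|n IHn] sep; first by rewrite /fan !big_ord0 add0r addr0.
have [//|w /and4P[w1 w2 w3 w4]] := sep n.
rewrite /fan !big_ord_recr /= -!/(fan _ _ _) -addrA.
rewrite (half_turns_cell w1 w2 w3 w4) addrA IHn ?addrA // => i /ltnW; exact: sep.
Qed.

Lemma fan_closed_shift p m x x' : p m = p 0%N ->
    (forall i, (i < m)%N -> exists w, separates w x x' (p i) (p i.+1)) ->
  fan p m x = fan p m x'.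
Proof. by move=> pm /fan_shift; rewrite pm addrC => /addrI. Qed.

Lemma parallelP a b : a != 0 -> cross a b = 0 ->
  b.1 = dot a b / dot a a * a.1 /\ b.2 = dot a b / dot a a * a.2.
Proof.
move=> /dot_gt0 aa; move: aa; case: a b => [a1 a2] [b1 b2].
rewrite /cross /dot /= => aa cr.
have e : a1 * b2 = a2 * b1 by apply/eqP; rewrite -subr_eq0 cr.
split; rewrite mulrAC; apply: (canRL (mulfK (lt0r_neq0 aa))).
  by transitivity (a1 * (a1 * b1) + a2 * (a2 * b1)); [|rewrite -e]; ring.
by transitivity (a2 * (a2 * b2) + a1 * (a1 * b2)); [|rewrite e]; ring.
Qed.

(** Of [a] and [c], the one nearer to [b] lies on both segments. *)
Lemma antiparallel_segments_overlap a b c :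
    a != b -> b != c -> cross (b - a) (c - b) = 0 -> dot (b - a) (c - b) < 0 ->
  exists q, [/\ q != b, segment a b q & segment b c q].
Proof.
move=> ab bc cr dt; have ba : b - a != 0 by rewrite subr_eq0 eq_sym.
have [e1 e2] := parallelP ba cr; set k := dot _ _ / _ in e1 e2.
have k0 : k < 0 by rewrite ltr_pdivrMr ?dot_gt0 // mul0r.
have [k1|k1] := lerP (-1) k.
  exists c; split; [by rewrite eq_sym| |exact: segmentr].
  apply/segmentP; exists (1 + k); split; [lra|lra|].
  by rewrite [LHS]surjective_pairing; move: e1 e2 => /= e1 e2; congr pair; lra.
exists a; split=> //; first exact: segmentl.
apply/segmentP; exists (- k^-1).
have k2 : k^-1 * k = 1 by rewrite mulVf // lt_eqF.
split; [by rewrite oppr_ge0 invr_le0 ltW| |].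
  by rewrite lerNl -(ler_nM2r k0) k2 mulN1r; lra.
rewrite [LHS]surjective_pairing; move: e1 e2 => /= -> ->.
by congr pair; rewrite mulrA mulNr k2; ring.
Qed.

(** A simple polygon does not fold back at a corner. This excludes the turn through pi, for which
    [half_turns] has an arbitrary value; the closing corner is treated in the next lemma. *)
Lemma consecutive_half_plane p m i : simple_closed p m -> (2 < m)%N ->
  (i.+1 < m)%N -> exists w, 0 < dot w (p i.+1 - p i) /\ 0 < dot w (p i.+2 - p i.+1).
Proof.
move=> [pm pn simp] m2 im; apply: acute_half_plane.
- by rewrite subr_eq0 eq_sym pn // ltnW.
- by rewrite subr_eq0 eq_sym pn.
move=> [cr dt].
have [q [qb s1 s2]] := antiparallel_segments_overlap (pn i (ltnW im)) (pn i.+1 im) cr dt.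
have [[_ qe]|[i0 mi _]] := simp i i.+1 q (ltnSn _) im s1 s2.
  by rewrite qe eqxx in qb.
by move: m2; rewrite -mi i0.
Qed.

Lemma closing_half_plane p m : simple_closed p m -> (2 < m)%N ->
  exists w, 0 < dot w (p m - p m.-1) /\ 0 < dot w (p 1%N - p 0%N).
Proof.
case: m => [|[|[|n]]] // [pm pn simp] _; rewrite [_.-1]/=.
have p1 : p n.+3 != p 1%N by rewrite pm pn.
have p2 := pn n.+2 (ltnSn _).
apply: acute_half_plane; rewrite -?pm ?subr_eq0 1?eq_sym // => -[cr dt].
have [q [qb s1 s2]] := antiparallel_segments_overlap p2 p1 cr dt.
rewrite pm in s2 qb.
have [[//]|[_ _ qe]] := simp 0%N n.+2 q (ltn0Sn _) (ltnSn _) s2 s1.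
by rewrite qe eqxx in qb.
Qed.

Lemma simple_closed_neq p m i j : simple_closed p m ->
  (i < j)%N -> (j < m)%N -> p i != p j.
Proof.
move=> [pm pn simp] ij jm; apply/eqP => e.
have := simp i j (p i) ij jm (segmentl _ _); rewrite {1}e => /(_ (segmentl _ _)).
case=> [[ji _]|[i0 jm' _]]; first by have := pn i (ltn_trans ij jm); rewrite e ji eqxx.
by have := pn j jm; rewrite jm' pm -e i0 eqxx.
Qed.

(* Hopf's homotopy: the direction p j - p i is transported across the triangle
   i < j from the diagonal, where it follows the sides of the polygon, to the
   two other sides, where it follows the rays from p 0. *)
Lemma turning_fan p n : simple_closed p n.+3 ->
  turning p n.+3 = 2 * (fan (fun i => p i.+1) n.+1 (p 0%N)
    + half_turns (p n.+2 - p 0%N) (p 0%N - p 1%N)).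
Proof.
move=> simp; have [pm pn disj] := simp.
have neq i j : (i < j)%N -> (j < n.+3)%N -> p j - p i != 0.
  by move=> ij jm; rewrite subr_eq0 eq_sym (simple_closed_neq simp).
have neqN i j : (i < j)%N -> (j < n.+3)%N -> p i - p j != 0.
  by move=> ij jm; rewrite subr_eq0 (simple_closed_neq simp).
have sep i j : (0 < i)%N -> (i.+1 < j)%N -> (j < n.+3)%N ->
    exists w, separates w (p j) (p j.+1) (p i) (p i.+1).
  move=> i0 ij jm; apply: disjoint_segments_separated => q s1 s2.
  have [[ji _]|[ii _ _]] := disj i j q (ltnW ij) jm s2 s1.
    by rewrite ji ltnn in ij.
  by rewrite ii in i0.
have sep0 j : (1 < j)%N -> (j < n.+2)%N ->
    exists w, separates w (p j) (p j.+1) (p 0%N) (p 1%N).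
  move=> ij jm; apply: disjoint_segments_separated => q s1 s2.
  have [[ji _]|[_ ii _]] := disj 0%N j q (ltnW ij) (leqW jm) s2 s1.
    by rewrite ji ltnn in ij.
  by case: ii jm => ->; rewrite ltnn.
(* The turn at a corner passes through the direction of the diagonal from [p i] to [p i.+2]. All
   three directions are reversed here, which leaves the counts unchanged. *)
have acute i : (i.+1 < n.+3)%N ->
    half_turns (p i.+1 - p i) (p i.+2 - p i.+1) =
    half_turns (p i - p i.+1) (p i - p i.+2)
    + half_turns (p i - p i.+2) (p i.+1 - p i.+2).
  move=> im; have [w [w1 w2]] := consecutive_half_plane simp isT im.
  have e u v : dot (- w) (u - v) = dot w (v - u) by rewrite /dot /=; ring.
  rewrite (@half_turnsD _ (- w)) ?e //; last first.
    by move: w1 w2; rewrite /dot /=; lra.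
  rewrite -half_turnsNN ?opprB //; first by rewrite neq.
  by rewrite subr_eq0 eq_sym pn.
pose T k := \sum_(i < k) half_turns (p i.+1 - p i) (p i.+2 - p i.+1).
(* The turning up to side [k] is the sweep of the ray from [p 0] to the corners up to [p k.+1], plus
   the sweep of the ray from [p k.+1] to the corners from [p 0] to [p k]; the induction adds one row
   of cells. *)
have open k : (k <= n.+1)%N -> T k = fan (fun i => p i.+1) k (p 0%N) + fan p k (p k.+1).
  elim: k => [|k IHk] kn; first by rewrite /T /fan !big_ord0.
  have S i : (i < k)%N -> exists w, separates w (p k.+1) (p k.+2) (p i) (p i.+1).
    by case: i => [|i] ik; [apply: sep0|apply: sep]; lia.
  have := fan_shift S.
  have <- : half_turns (p k.+1 - p 0%N) (p k.+2 - p 0%N)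
      = half_turns (p 0%N - p k.+1) (p 0%N - p k.+2).
    by rewrite -half_turnsNN ?opprB ?neq //; lia.
  rewrite !fanS /T big_ord_recr /= -/(T k) (IHk (ltnW kn)) acute; lia.
rewrite /turning /= big_ord_recr /= -/(T n.+1) open // acute //.
have S i : (i < n)%N ->
    exists w, separates w (p n.+2) (p n.+3) (p i.+1) (p i.+2).
  by move=> ik; apply: sep; lia.
(* Moving the apex of the second fan along the last side to [p n.+3], which is [p 0], turns it into
   the first fan; hence the factor 2. *)
have := @fan_shift (fun i => p i.+1) n (p n.+2) (p n.+3) S.
have -> : fan p n.+1 (p n.+2) =
    half_turns (p 0%N - p n.+2) (p 1%N - p n.+2) + fan (fun i => p i.+1) n (p n.+2).
  by rewrite /fan big_ord_recl.
move=> h.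
have [w [w1 w2]] := closing_half_plane simp isT.
rewrite /= in w1.
have e1 : half_turns (p 0%N - p n.+2) (p 1%N - p n.+2) + half_turns (p 1%N - p n.+2) (p 1%N - p n.+3) =
    half_turns (p n.+2 - p 0%N) (p 0%N - p 1%N).
  rewrite pm in w1 *; rewrite (@half_turnsD _ w) //; last first.
    by move: w1 w2; rewrite /dot /=; lra.
  by rewrite -(half_turnsNN (@neqN 0%N n.+2 _ _) (@neq 0%N 1%N _ _)) ?opprB.
have e2 : half_turns (p n.+3 - p n.+2) (p 1%N - p 0%N) = half_turns (p n.+2 - p 0%N) (p 0%N - p 1%N).
  by rewrite pm -(half_turnsNN (@neqN 0%N n.+2 _ _) (@neq 0%N 1%N _ _)) ?opprB.
rewrite e2 -e1.
have e3 : fan (fun i => p i.+1) n.+1 (p 0%N) = fan (fun i => p i.+1) n (p n.+3)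
    + half_turns (p n.+1 - p n.+3) (p n.+2 - p n.+3) by rewrite fanS pm.
by lia.
Qed.
End Turning.

(** * Cyclic order of three directions and half turns *)

Section Orientation.
Variable R : realType.
Local Notation plane := (R * R)%type.
Implicit Types (a b c d f w x y q : plane) (p : nat -> plane).
Local Open Scope classical_set_scope.

(** The three vectors lie in one half-plane that contains exactly one of its two bounding rays, and
    there a positive [cross] means a larger angle. *)
Lemma upper_cross_trans a b c : upper b = upper a -> upper c = upper a ->
  0 < cross a b -> 0 < cross b c -> 0 < cross a c.
Proof.
case: a b c => [a1 a2] [b1 b2] [c1 c2]; rewrite /upper /cross /=.
case: (ltgtP a2 0) (ltgtP b2 0) (ltgtP c2 0) => ha [] hb [] hc //=;
  rewrite ?ha ?hb ?hc ?mulr0 ?mul0r ?subr0 ?sub0r;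
  try (move=> _ _; nra); case: (ltrP 0 a1); case: (ltrP 0 b1); case: (ltrP 0 c1); nra.
Qed.

(** Evaluates the counts that are left over in [turning_ccw]. Each vector is replaced by whichever
    of itself and its opposite is [upper]; the signs of the three cross products are then all that
    matters, and transitivity rules out the patterns that no triple realises. *)
Lemma ccw_half_turns a d f : a != 0 -> d != 0 -> f != 0 -> ccw a d f ->
  half_turns a (- f) - half_turns a (- d) - half_turns (- d) f = 1.
Proof.
have T := upper_cross_trans.
have X x y : cross x (- y) = - cross x y by rewrite /cross /=; ring.
have Y x y : cross (- x) y = - cross x y by rewrite /cross /=; ring.
move=> a0 d0 f0; rewrite /ccw /half_turns !upperN // !X !Y !oppr_gt0 !oppr_lt0.
pose s x := if upper x then x else - x.
have {T}T x y z : x != 0 -> y != 0 -> z != 0 ->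
    0 < cross (s x) (s y) -> 0 < cross (s y) (s z) -> 0 < cross (s x) (s z).
  have S v : v != 0 -> upper (s v) by rewrite /s; case: ifP => // + /upperN => -> ->.
  by move=> x0 y0 z0; apply: T; rewrite !S.
have := T a d f a0 d0 f0; have := T d f a d0 f0 a0; have := T f a d f0 a0 d0.
have := T a f d a0 f0 d0; have := T f d a f0 d0 a0; have := T d a f d0 a0 f0.
rewrite /s [cross f a]crossN {T}.
case: (upper a); case: (upper d); case: (upper f) => /=;
  rewrite ?X ?Y ?[cross f a]crossN ?[cross d a]crossN ?[cross f d]crossN;
  rewrite ?opprK ?oppr_gt0 ?oppr_lt0;
  case: (ltgtP (cross a d) 0) => _; case: (ltgtP (cross d f) 0) => _;
  case: (ltgtP (cross a f) 0) => _ //= T1 T2 T3 T4 T5 T6;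
  by [|move: (T1 isT isT)|move: (T2 isT isT)|move: (T3 isT isT)
      |move: (T4 isT isT)|move: (T5 isT isT)|move: (T6 isT isT)].
Qed.

End Orientation.

(** * Winding numbers and the sign of the turning *)

Section Winding.
Variable R : realType.
Local Notation plane := (R * R)%type.
Implicit Types (a b c d f w x y q : plane) (p : nat -> plane).
Local Open Scope classical_set_scope.

Lemma near_lt (T : Type) (F : set_system T) {FF : Filter F} m (P : nat -> T -> Prop) :
  (forall i, (i < m)%N -> \forall y \near F, P i y) ->
  \forall y \near F, forall i, (i < m)%N -> P i y.
Proof.
elim: m => [|m IHm] h; first by apply: filterE.
have h1 := IHm (fun i im => h i (ltnW im)); have h2 := h m (ltnSn m).
apply: filterS2 h1 h2 => y h1 h2 i; rewrite ltnS leq_eqVlt => /orP[/eqP->//|]; exact: h1.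
Qed.

Lemma dot_cvg w a y : dot w (a - z) @[z --> y] --> dot w (a - y).
Proof.
have c1 : (fun z : plane => z.1) @ y --> y.1 by exact: cvg_fst.
have c2 : (fun z : plane => z.2) @ y --> y.2 by exact: cvg_snd.
by apply: cvgD; (apply: cvgM; first exact: cvg_cst); (apply: cvgB; first exact: cvg_cst).
Qed.

Lemma near_separates x y a b :
    (forall q, segment x y q -> segment a b q -> False) ->
  \forall y' \near y, exists w, separates w x y' a b.
Proof.
move=> /disjoint_segments_separated[w /and4P[w1 w2 w3 w4]].
near=> y'; exists w; rewrite /separates w1 w2 /=; apply/andP; split; near: y'.
  exact: (cvgr_gt _ (@dot_cvg w a y)).
exact: (cvgr_gt _ (@dot_cvg w b y)).
Unshelve. all: end_near. Qed.

Lemma near_fan p m y : p m = p 0%N ->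
    (forall i, (i < m)%N -> ~ segment (p i) (p i.+1) y) ->
  \forall y' \near y, fan p m y = fan p m y'.
Proof.
move=> pm ny.
have : \forall y' \near y, forall i, (i < m)%N -> exists w, separates w y y' (p i) (p i.+1).
  apply: (@near_lt _ (nbhs y) _ m (fun i y' => exists w, separates w y y' (p i) (p i.+1))).
  move=> i im; apply: near_separates => q.
  move=> /segmentP[t [_ _ ->]]; rewrite !subrr !mulr0 !addr0 -surjective_pairing.
  exact: ny.
by apply: filterS => y'; exact: fan_closed_shift.
Qed.

(** Seen from [y], the polygon lies in an open half-plane, whose normal is parallel to the axis of
    the larger coordinate of [y] since the norm is the maximum norm. There the counts add up to that
    from the first point to the last, and these coincide. *)
Lemma fan_far p m y : p m = p 0%N -> (forall i, (i <= m)%N -> `|p i| < `|y|) ->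
  fan p m y = 0.
Proof.
move=> pm far.
have [w wp] : exists w, forall i, (i <= m)%N -> 0 < dot w (p i - y).
  case: y far => y1 y2; rewrite prod_normE /= => far.
  have [h|h] := leP `|y2| `|y1|.
    exists (- y1, 0) => i /far; rewrite prod_normE gt_max /dot /= => /andP[+ _].
    rewrite max_l // => {}h; rewrite mul0r addr0.
    move: h; rewrite ltr_norml; case: (lerP 0 y1) => y0; rewrite ?(ger0_norm y0) ?(ltr0_norm y0);
      case/andP; nra.
  exists (0, - y2) => i /far; rewrite prod_normE gt_max /dot /= => /andP[_ +].
  rewrite max_r ?ltW // => {}h; rewrite mul0r add0r.
  move: h; rewrite ltr_norml; case: (lerP 0 y2) => y0; rewrite ?(ger0_norm y0) ?(ltr0_norm y0);
      case/andP; nra.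
have : fan p m y = half_turns (p 0%N - y) (p m - y).
  elim: {-2}m (leqnn m) => [_|n IHn nm]; first by rewrite /fan big_ord0 /half_turns eqxx.
  rewrite fanS IHn ?(ltnW nm) // (@half_turnsD _ w) ?wp //; exact: ltnW.
by rewrite pm /half_turns eqxx.
Qed.

(** The winding number is locally constant off the polygon, hence constant on a component of the
    complement of [A]; an unbounded component contains a point far from the polygon. *)
Lemma fan_unbounded_component p m (A : set plane) x : p m = p 0%N ->
    (forall i, (i < m)%N -> segment (p i) (p i.+1) `<=` A) ->
    ~ A x -> ~ bounded_set (connected_component (~` A) x) ->
  fan p m x = 0.
Proof.
move=> pm pA Ax unb; set C := connected_component _ _ in unb.
have CA : C `<=` ~` A := @connected_component_sub _ _ _.
have const y : C y -> fan p m y = fan p m x.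
  move=> Cy; pose B := C `&` [set z | fan p m z = fan p m x].
  suff BC : B = C by move: Cy; rewrite -BC => -[].
  have near y' : C y' -> \forall z \near y', fan p m y' = fan p m z.
    by move=> /CA nA; apply: near_fan => // i im /(pA i im).
  apply: (@component_connected _ (~` A) x).
  - exists x; split=> //; exact: connected_component_refl.
  - exists (interior [set z | fan p m z = fan p m x]); first exact: open_interior.
    apply/seteqP; split=> z [Cz]; last by move/interior_subset.
    move=> /= e; split=> //; move: (near z Cz); rewrite /interior /=.
    by apply: filterS => z' /= <-.
  exists (~` interior [set z | fan p m z != fan p m x]); first exact/open_closedC/open_interior.
  apply/seteqP; split=> z [Cz] /= h; split=> //.
    by move/interior_subset; rewrite /= h eqxx.
  apply/eqP; apply/negPn/negP => e; apply: h; move: (near z Cz); rewrite /interior /=.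
  by apply: filterS => z' /= <-.
have [y [Cy far]] : exists y, C y /\ forall i, (i <= m)%N -> `|p i| < `|y|.
  apply: contrapT => no; apply: unb.
  rewrite /= /bounded_near; near=> M => y Cy /=.
  apply: (@le_trans _ _ (\sum_(i < m.+1) `|p i|)); last first.
    by near: M; apply: nbhs_pinfty_ge; rewrite num_real.
  rewrite leNgt; apply/negP => h; apply: no; exists y; split=> // i im.
  apply: le_lt_trans h; rewrite (bigD1 (Ordinal (im : (i < m.+1)%N))) //= lerDl.
  exact: sumr_ge0.
by rewrite -(const y Cy) fan_far.
Unshelve. all: end_near. Qed.

Lemma ccw_rot a b c : ccw a b c = ccw b c a.
Proof. by rewrite /ccw; case: (0 < _); case: (0 < _); case: (0 < _). Qed.

Lemma ccw_not_parallel a b c : a != 0 -> b != 0 -> ccw a b c || ccw a c b ->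
  ~ (cross a b = 0 /\ 0 < dot a b).
Proof.
move=> a0 b0 o [cr dt]; have [e1 e2] := parallelP a0 cr.
have k0 : 0 < dot a b / dot a a by rewrite divr_gt0 // dot_gt0.
move: (_ / _) k0 e1 e2 => k k0 e1 e2.
have E1 : cross b c = k * cross a c by rewrite /cross e1 e2; ring.
move: o; rewrite /ccw [cross c a]crossN [cross b a]crossN [cross c b]crossN cr.
rewrite E1 oppr0 ltxx /= !oppr_gt0 andbF orbF /= !(pmulr_rgt0 _ k0) !(pmulr_rlt0 _ k0).
by case: ltgtP.
Qed.

Lemma half_turns_triangle a d : a != 0 -> d != 0 ->
    ~ (cross a d = 0 /\ 0 < dot a d) ->
  half_turns a (a - d) + half_turns (a - d) (- d) = half_turns a (- d).
Proof.
move=> a0 d0 np.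
have e1 : cross a (- d) = - cross a d by rewrite /cross /=; ring.
have e2 : dot a (- d) = - dot a d by rewrite /dot /=; ring.
have [w [w1 w2]] : exists w, 0 < dot w a /\ 0 < dot w (- d).
  apply: acute_half_plane; rewrite ?oppr_eq0 // e1 e2 => -[/eqP cr dt].
  by apply: np; split; [apply/eqP; rewrite -oppr_eq0|rewrite -oppr_lt0].
by apply: (@half_turnsD _ w) => //; move: w1 w2; rewrite /dot /=; lra.
Qed.

(* a and f point from p 0 to its two neighbours and d to x; as x has winding
   number 0, the turning is the sign of the cyclic order of a, d and f. *)
Lemma turning_ccw p n x : simple_closed p n.+3 ->
    (forall i, (i < n.+1)%N ->
      exists w, separates w (p 0%N) x (p i.+1) (p i.+2)) ->
    fan p n.+3 x = 0 ->
    ccw (p n.+2 - p 0%N) (x - p 0%N) (p 1%N - p 0%N) ->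
  turning p n.+3 = 2.
Proof.
move=> simp sep fx o; rewrite turning_fan //.
have [pm _ _] := simp; have pn := simple_closed_neq simp.
set a := p n.+2 - p 0%N in o *; set d := x - p 0%N in o *.
set f := p 1%N - p 0%N in o *.
have a0 : a != 0 by rewrite subr_eq0 eq_sym pn.
have f0 : f != 0 by rewrite subr_eq0 eq_sym pn.
have d0 : d != 0.
  apply/eqP => d0; move: o; rewrite d0 /ccw /cross /= !mulr0 !mul0r subrr ltxx /=.
  by rewrite andbF.
have h1 : half_turns a (a - d) + half_turns (a - d) (- d) = half_turns a (- d).
  by apply: half_turns_triangle => //; apply: (ccw_not_parallel (c := f)); rewrite ?o.
have h2 : half_turns f (f - d) + half_turns (f - d) (- d) = half_turns f (- d).
  apply: half_turns_triangle => //; apply: (ccw_not_parallel (c := a)) => //.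
  by rewrite [ccw f a d]ccw_rot o orbT.
have := ccw_half_turns a0 d0 f0 o.
have e0 : p 0%N - x = - d by rewrite opprB.
have ex q : q - x = q - p 0%N - d by rewrite /d opprB addrA subrK.
have fan3 : fan p n.+3 x = half_turns (- d) (f - d)
    + fan (fun i => p i.+1) n.+1 x + half_turns (a - d) (- d).
  by rewrite fanS pm e0 /fan big_ord_recl e0 !ex.
(* Moving the apex from [p 0] to [x] across the sides that do not end at [p 0] compares the fan of
   [turning_fan] with the winding number of [x]; the difference is the one that [ccw_half_turns]
   evaluates. *)
have := fan_shift sep; rewrite -/a -/f ![in X in X -> _]ex -/a -/f.
have -> : p 0%N - p 1%N = - f by rewrite opprB.
move: fx; rewrite fan3 [half_turns (- d) (f - d)]half_turns_sym.
rewrite [half_turns (- d) f]half_turns_sym.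
lia.
Qed.

End Winding.

(** * Octilinear polylines *)

Section Octilinear.
Variable R : realType.
Local Notation plane := (R * R)%type.
Implicit Types (a b c d f w x y q : plane) (p : nat -> plane) (s : seq plane).

Definition compass (i : nat) : int * int :=
  nth 0 [:: (1, 0); (1, 1); (0, 1); (-1, 1); (-1, 0); (-1, -1); (0, -1); (1, -1)] i.

Definition heading a : nat :=
  if a.2 == 0 then if 0 < a.1 then 0%N else 4%N
  else if a.1 == 0 then if 0 < a.2 then 2%N else 6%N
  else if a.1 == a.2 then if 0 < a.1 then 1%N else 5%N
  else if 0 < a.1 then 7%N else 3%N.

Lemma headingP a : octilinear_vector a -> a != 0 ->
  (heading a < 8)%N /\ exists k : R, [/\ 0 < k, a.1 = k * (compass (heading a)).1%:~R
    & a.2 = k * (compass (heading a)).2%:~R].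
Proof.
case: a => a1 a2; rewrite /octilinear_vector xpair_eqE /heading /=.
case: (ltgtP a2 0) => [h|h|->]; case: (ltgtP a1 0) => [h'|h'|->] //=.
all: try (by rewrite eqxx).
all: move=> o _; try (case: (eqVneq a1 a2) o => [e|ne] /= o; try (move/eqP: o => o));
  try (exfalso; lra).
all: split=> //; rewrite /= ?(mulrN1z, mulr1z, mulr0z).
all: by [exists a1; split; lra|exists (- a1); split; lra
        |exists a2; split; lra|exists (- a2); split; lra].
Qed.

Definition ccross (i j : nat) : int :=
  (compass i).1 * (compass j).2 - (compass i).2 * (compass j).1.

Definition cdot (i j : nat) : int :=
  (compass i).1 * (compass j).1 + (compass i).2 * (compass j).2.

(** A nonzero octilinear vector is a positive multiple of its compass vector, so the signs of
    [cross] and [dot] depend on the headings only. Statements on turns of octilinear vectors thereby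
    become finite checks. *)
Lemma cross_heading a b : octilinear_vector a -> a != 0 ->
    octilinear_vector b -> b != 0 ->
  [/\ (0 < cross a b) = (0 < ccross (heading a) (heading b)),
      (cross a b < 0) = (ccross (heading a) (heading b) < 0)
    & (0 < dot a b) = (0 < cdot (heading a) (heading b))].
Proof.
move=> oa a0 ob b0; have [_ [k [k0 a1 a2]]] := headingP oa a0.
have [_ [l [l0 b1 b2]]] := headingP ob b0.
have -> : cross a b = k * l * (ccross (heading a) (heading b))%:~R.
  by rewrite /cross /ccross a1 a2 b1 b2 rmorphB !rmorphM /=; ring.
have -> : dot a b = k * l * (cdot (heading a) (heading b))%:~R.
  by rewrite /dot /cdot a1 a2 b1 b2 rmorphD !rmorphM /=; ring.
have kl : 0 < k * l by rewrite mulr_gt0.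
by rewrite !(pmulr_rgt0 _ kl) (pmulr_rlt0 _ kl) !ltr0z ltrz0.
Qed.

Lemma upper_heading a : octilinear_vector a -> a != 0 -> upper a = (heading a < 4)%N.
Proof.
case: a => a1 a2; rewrite /octilinear_vector xpair_eqE /heading /upper /=.
case: (ltgtP a2 0) => [h|h|->]; case: (ltgtP a1 0) => [h'|h'|->] //=.
all: try (by rewrite eqxx).
all: try (by case: ifP).
all: by case: (eqVneq a1 a2) => //= e /eqP o; exfalso; lra.
Qed.

Lemma headingN a : octilinear_vector a -> a != 0 ->
  heading (- a) = ((heading a + 4) %% 8)%N.
Proof.
case: a => a1 a2; rewrite /octilinear_vector xpair_eqE /heading /=.
rewrite !oppr_eq0 eqr_opp !oppr_gt0.
case: (ltgtP a2 0) => [h|h|->]; case: (ltgtP a1 0) => [h'|h'|->] //=.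
all: try (by rewrite eqxx).
all: by case: (eqVneq a1 a2).
Qed.

Definition chalf (i j : nat) : int :=
  if (i < 4)%N == (j < 4)%N then 0
  else if 0 < ccross i j then 1 else if ccross i j < 0 then -1 else 0.

(** A heading modulo 4 is the angle, in units, of the spanned line above the horizontal. The turn is
    the change of this angle plus 4 for each time the line becomes horizontal. *)
Definition cturn (i j : nat) : int := (j %% 4)%N%:Z - (i %% 4)%N%:Z + 4 * chalf i j.

Definition cccw (i j k : nat) : bool :=
  [|| (0 < ccross i j) && (0 < ccross j k), (0 < ccross j k) && (0 < ccross k i)
    | (0 < ccross k i) && (0 < ccross i j)].

(* The turn from a to b in units of pi/4, between -3 and 3; the value 0 for
   opposite vectors is arbitrary. *)
Definition eighth_turn a b : int := cturn (heading a) (heading b).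

Lemma eighth_turnE a b : octilinear_vector a -> a != 0 ->
    octilinear_vector b -> b != 0 ->
  eighth_turn a b = (heading b %% 4)%N%:Z - (heading a %% 4)%N%:Z + 4 * half_turns a b.
Proof.
move=> oa a0 ob b0; have [e1 e2 _] := cross_heading oa a0 ob b0.
by rewrite /eighth_turn /cturn /chalf /half_turns e1 e2 !upper_heading.
Qed.

Let below8 := iota 0 8.
Let in8 i : (i < 8)%N -> i \in below8. Proof. by rewrite mem_iota. Qed.

Lemma eighth_turn_bound a b : octilinear_vector a -> a != 0 ->
  octilinear_vector b -> b != 0 -> eighth_turn a b <= 3.
Proof.
move=> oa a0 ob b0; have [/in8 ia _] := headingP oa a0; have [/in8 ib _] := headingP ob b0.
have /allP/(_ _ ia)/allP/(_ _ ib) //: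
  all (fun i => all (fun j => cturn i j <= 3) below8) below8 by vm_compute.
Qed.

Lemma eighth_turn_same a b : octilinear_vector a -> a != 0 ->
  octilinear_vector b -> b != 0 -> same_direction a b -> eighth_turn a b = 0.
Proof.
move=> oa a0 ob b0; have [/in8 ia _] := headingP oa a0; have [/in8 ib _] := headingP ob b0.
have [e1 e2 e3] := cross_heading oa a0 ob b0.
have /allP/(_ _ ia)/allP/(_ _ ib)/implyP h:
  all (fun i => all (fun j => [&& ~~ (0 < ccross i j), ~~ (ccross i j < 0) & 0 < cdot i j]
     ==> (cturn i j == 0)) below8) below8 by vm_compute.
rewrite /same_direction => /andP[/eqP cr dt]; apply/eqP/h.
by rewrite -e1 -e2 -e3 cr ltxx.
Qed.

Lemma eighth_turn_rev a b : octilinear_vector a -> a != 0 ->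
  octilinear_vector b -> b != 0 -> eighth_turn (- b) (- a) = - eighth_turn a b.
Proof.
move=> oa a0 ob b0; have [/in8 ia _] := headingP oa a0; have [/in8 ib _] := headingP ob b0.
rewrite /eighth_turn !headingN //.
have /allP/(_ _ ia)/allP/(_ _ ib)/eqP -> //:
  all (fun i => all (fun j => cturn ((j + 4) %% 8) ((i + 4) %% 8) == - cturn i j) below8) below8
  by vm_compute.
Qed.

Lemma ccw_heading a b c : octilinear_vector a -> a != 0 ->
  octilinear_vector b -> b != 0 -> octilinear_vector c -> c != 0 ->
  ccw a b c = cccw (heading a) (heading b) (heading c).
Proof.
move=> oa a0 ob b0 oc c0; rewrite /ccw /cccw.
have [-> _ _] := cross_heading oa a0 ob b0.
have [-> _ _] := cross_heading ob b0 oc c0.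
by have [-> _ _] := cross_heading oc c0 oa a0.
Qed.

(** The path arrives against [a] and leaves along [f], and its inner angle runs counterclockwise
    from [f] to [a]. An edge strictly inside makes this angle at least 2 units, and the turn is 4
    minus the angle; in the next lemma two edges make it at least 3. *)
Lemma eighth_turn_ccw2 a b f : octilinear_vector a -> a != 0 ->
    octilinear_vector b -> b != 0 -> octilinear_vector f -> f != 0 ->
  ccw f b a -> eighth_turn (- a) f <= 2.
Proof.
move=> oa a0 ob b0 of_ f0; rewrite ccw_heading // /eighth_turn headingN //.
have [/in8 ia _] := headingP oa a0; have [/in8 ib _] := headingP ob b0.
have [/in8 iff _] := headingP of_ f0.
have /allP/(_ _ ia)/allP/(_ _ ib)/allP/(_ _ iff)/implyP //:
  all (fun i => all (fun j => all (fun k => cccw k j i ==> (cturn ((i + 4) %% 8) k <= 2))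
    below8) below8) below8 by vm_compute.
Qed.

Lemma eighth_turn_ccw3 a b c f : octilinear_vector a -> a != 0 ->
    octilinear_vector b -> b != 0 -> octilinear_vector c -> c != 0 ->
    octilinear_vector f -> f != 0 ->
  ccw f b a -> ccw b c a -> eighth_turn (- a) f <= 1.
Proof.
move=> oa a0 ob b0 oc c0 of_ f0; rewrite !ccw_heading // /eighth_turn headingN //.
have [/in8 ia _] := headingP oa a0; have [/in8 ib _] := headingP ob b0.
have [/in8 ic _] := headingP oc c0; have [/in8 iff _] := headingP of_ f0.
move=> h1 h2; move: h1 h2.
have /allP/(_ _ ia)/allP/(_ _ ib)/allP/(_ _ ic)/allP/(_ _ iff)/implyP h:
  all (fun i => all (fun j => all (fun l => all (fun k => cccw k j i && cccw j l i ==>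
   (cturn ((i + 4) %% 8) k <= 1)) below8) below8) below8) below8 by vm_compute.
by move=> h1 h2; apply: h; rewrite h1 h2.
Qed.

End Octilinear.

(** * Turning and bends of polylines *)

Section Polylines.
Variable R : realType.
Local Notation plane := (R * R)%type.
Implicit Types (a b c d f w x y q : plane) (s t : seq plane).
Local Open Scope classical_set_scope.

Definition first_step s : plane := s`_1 - s`_0.
Definition last_step s : plane := s`_(size s).-1 - s`_(size s).-2.

Definition octilinear_steps s : Prop :=
  forall i, (i.+1 < size s)%N -> octilinear_vector (s`_i.+1 - s`_i) /\ s`_i.+1 - s`_i != 0.

Definition polyline_turning s : int :=
  \sum_(i < (size s).-2) eighth_turn (s`_i.+1 - s`_i) (s`_i.+2 - s`_i.+1).

(** Meant for a [t] that starts where [s] ends: the common point is kept once. *)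
Definition join s t := s ++ behead t.

Lemma polyline_turning_bound s : octilinear_steps s ->
  polyline_turning s <= 3 * (polyline_bends s)%:Z.
Proof.
move=> os; rewrite /polyline_turning /polyline_bends -[X in _ * X]natz natr_sum mulr_sumr.
apply: ler_sum => -[i im] _ /=.
have [v1 n1] : octilinear_vector (s`_i.+1 - s`_i) /\ s`_i.+1 - s`_i != 0 by apply: os; lia.
have [v2 n2] : octilinear_vector (s`_i.+2 - s`_i.+1) /\ s`_i.+2 - s`_i.+1 != 0 by apply: os; lia.
case: (boolP (same_direction _ _)) => h /=; last exact: eighth_turn_bound.
by rewrite eighth_turn_same.
Qed.

(** The codomain is general so as to serve both the turning, an integer, and the number of bends, a
    natural number. *)
Lemma sum_steps_rev (V : nmodType) (F : plane -> plane -> V) s :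
  \sum_(i < (size (rev s)).-2)
     F ((rev s)`_i.+1 - (rev s)`_i) ((rev s)`_i.+2 - (rev s)`_i.+1) =
  \sum_(i < (size s).-2) F (- (s`_i.+2 - s`_i.+1)) (- (s`_i.+1 - s`_i)).
Proof.
rewrite size_rev [RHS](reindex_inj rev_ord_inj); apply: eq_bigr => -[i im] _ /=.
by rewrite !opprB !nth_rev; try lia; congr (F (_ - _) (_ - _)); congr nth; lia.
Qed.

Lemma polyline_turning_rev s : octilinear_steps s ->
  polyline_turning (rev s) = - polyline_turning s.
Proof.
move=> os; rewrite /polyline_turning sum_steps_rev -sumrN.
apply: eq_bigr => -[i im] _ /=.
have [v1 n1] : octilinear_vector (s`_i.+1 - s`_i) /\ s`_i.+1 - s`_i != 0 by apply: os; lia.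
have [v2 n2] : octilinear_vector (s`_i.+2 - s`_i.+1) /\ s`_i.+2 - s`_i.+1 != 0 by apply: os; lia.
by rewrite eighth_turn_rev.
Qed.

Lemma polyline_bends_rev s : polyline_bends (rev s) = polyline_bends s.
Proof.
have := sum_steps_rev (fun a b => (~~ same_direction a b : nat)) s.
rewrite /polyline_bends => ->; apply: eq_bigr => i _; congr (nat_of_bool (~~ _)).
rewrite /same_direction crossNN crossN oppr_eq0; congr (_ && (0 < _)).
by rewrite /dot /=; ring.
Qed.

Lemma polyline_turning_cons x y z s :
  polyline_turning [:: x, y, z & s] =
  eighth_turn (y - x) (z - y) + polyline_turning [:: y, z & s].
Proof. by rewrite /polyline_turning big_ord_recl. Qed.

Lemma polyline_turning_join s t : (1 < size s)%N -> (1 < size t)%N ->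
    s`_(size s).-1 = t`_0 ->
  polyline_turning (join s t) = polyline_turning s +
    eighth_turn (last_step s) (first_step t) + polyline_turning t.
Proof.
case/lastP: s => // s y; case/lastP: s => // s x; case: t => [|y' [|z t]] // _ _.
rewrite /last_step /first_step !size_rcons /= nth_rcons size_rcons ltnn eqxx => <- {y'}.
rewrite !nth_rcons !size_rcons !ltnSn ltnn !eqxx /join /= !cat_rcons.
have two : polyline_turning [:: x; y] = 0 by rewrite /polyline_turning big_ord0.
elim: s => [|a [|b s] IHs].
- by rewrite /= polyline_turning_cons two add0r.
- by rewrite /= !polyline_turning_cons two addr0 -!addrA.
by case: s IHs => [|c s] /= IHs; rewrite polyline_turning_cons IHs
  [in RHS]polyline_turning_cons -!addrA.
Qed.

(** The headings modulo 4 telescope to 0 around the closed polygon, so only the half turns remain,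
    each worth 4 units. *)
Lemma closed_turning s : octilinear_steps s -> (2 < size s)%N ->
  s`_(size s).-1 = s`_0 ->
  4 * turning (nth 0 s) (size s).-1 =
  polyline_turning s + eighth_turn (last_step s) (first_step s).
Proof.
move=> os s2 cl; set m := (size s).-1.
have S i : (i < m)%N -> octilinear_vector (s`_i.+1 - s`_i) /\ s`_i.+1 - s`_i != 0.
  by rewrite /m => im; apply: os; lia.
pose H (i : nat) : int := Posz (modn (heading (s`_i.+1 - s`_i)) 4).
have m1 : m.-1.+1 = m by rewrite /m; lia.
rewrite /polyline_turning.
rewrite (_ : \sum_(i < _) _ = \sum_(0 <= i < m.-1) (H i.+1 - H i) +
   4 * \sum_(i < m.-1) half_turns (s`_i.+1 - s`_i) (s`_i.+2 - s`_i.+1)); last first.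
  rewrite big_mkord mulr_sumr -big_split; apply: eq_bigr => -[i im] _ /=.
  have [v1 n1] : octilinear_vector (s`_i.+1 - s`_i) /\ s`_i.+1 - s`_i != 0 by apply: S; lia.
  have [v2 n2] : octilinear_vector (s`_i.+2 - s`_i.+1) /\ s`_i.+2 - s`_i.+1 != 0 by apply: S; lia.
  by rewrite eighth_turnE.
rewrite telescope_sumr // /last_step /first_step -/m.
have [v1 n1] : octilinear_vector (s`_m.-1.+1 - s`_m.-1) /\ s`_m.-1.+1 - s`_m.-1 != 0 by apply: S; lia.
have [v2 n2] : octilinear_vector (s`_1 - s`_0) /\ s`_1 - s`_0 != 0 by apply: S; lia.
rewrite m1 in v1 n1; rewrite eighth_turnE // /turning /H m1; ring.
Qed.

Lemma size_join s t : (0 < size t)%N -> size (join s t) = (size s + (size t).-1)%N.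
Proof. by move=> t0; rewrite size_cat size_behead. Qed.

Lemma nth_joinl s t i : (i < size s)%N -> (join s t)`_i = s`_i.
Proof. by move=> si; rewrite nth_cat si. Qed.

Lemma nth_joinr s t i : (0 < size s)%N -> s`_(size s).-1 = t`_0 ->
  (join s t)`_((size s).-1 + i) = t`_i.
Proof.
move=> s0 st; case: i => [|i]; first by rewrite addn0 nth_joinl ?st //; lia.
by rewrite nth_cat ltnNge (_ : size s <= _)%N //= ?nth_behead; [congr nth; lia|lia].
Qed.

Lemma simple_polyline_head s i : simple_polyline s -> (i.+1 < size s)%N ->
  segment s`_i s`_i.+1 s`_0 -> i = 0%N.
Proof.
move=> [sn ss]; case: i => // i im h.
have [e1 e2] := ss 0%N i.+1 s`_0 (ltn0Sn _) im (segmentl _ _) h.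
have h1 : (1 < size s)%N by lia.
by have := sn 0%N h1; rewrite {1}e2 e1 eqxx.
Qed.

Lemma simple_polyline_last s i : simple_polyline s -> (i.+1 < size s)%N ->
  segment s`_i s`_i.+1 s`_(size s).-1 -> i.+2 = size s.
Proof.
move=> [sn ss] im h; have [//|ne] := eqVneq i.+2 (size s).
have S : (size s).-2.+1 = (size s).-1 by lia.
have h2 : segment s`_(size s).-2 s`_(size s).-2.+1 s`_(size s).-1.
  by rewrite S; exact: segmentr.
have [||e1 e2] := ss i (size s).-2 _ _ _ h h2; try lia.
have h3 : ((size s).-2.+1 < size s)%N by lia.
by have := sn (size s).-2 h3; rewrite -e2 S eqxx.
Qed.

Lemma polyline_join s t q : (0 < size s)%N -> (0 < size t)%N ->
  s`_(size s).-1 = t`_0 -> polyline (join s t) q -> polyline s q \/ polyline t q.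
Proof.
move=> s0 t0 st [i]; rewrite size_join // => iu.
have [h|h] := ltnP i.+1 (size s).
  by rewrite !nth_joinl ?(ltnW h) // => hq; left; exists i.
have -> : i = ((size s).-1 + (i - (size s).-1))%N by lia.
rewrite -addnS !nth_joinr // => hq; right; exists (i - (size s).-1)%N => //; lia.
Qed.

(** [C] tells whether the far ends of [s] and [t] may coincide: it is [False] when two sides of a
    triangle are glued and [True] when the third side closes it. *)
Lemma simple_join (C : Prop) s t : simple_polyline s -> simple_polyline t ->
    (1 < size s)%N -> (1 < size t)%N -> s`_(size s).-1 = t`_0 ->
    (forall q, polyline s q -> polyline t q ->
      q = t`_0 \/ [/\ C, q = s`_0 & q = t`_(size t).-1]) ->
    let u := join s t in
  (forall i, (i.+1 < size u)%N -> u`_i != u`_i.+1) /\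
  (forall i j q, (i < j)%N -> (j.+1 < size u)%N ->
     segment u`_i u`_i.+1 q -> segment u`_j u`_j.+1 q ->
     (j = i.+1 /\ q = u`_j) \/ [/\ C, i = 0%N, j.+2 = size u & q = u`_0]).
Proof.
move=> ss ts s1 t1 st meet u.
have s0 := ltnW s1; have t0 := ltnW t1; have [sn sd] := ss; have [tn td] := ts.
have su : size u = (size s + (size t).-1)%N by rewrite size_join.
have split i : ((size s).-1 <= i)%N -> i = ((size s).-1 + (i - (size s).-1))%N by lia.
have ul i : (i < size s)%N -> u`_i = s`_i by exact: nth_joinl.
have ur i : u`_((size s).-1 + i) = t`_i by exact: nth_joinr.
split=> [i|i j q ij]; rewrite su => iu.
  have [h|h] := ltnP i.+1 (size s); first by rewrite !ul ?(ltnW h) // sn.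
  by rewrite (split i) -?addnS ?ur ?tn //; lia.
have [hj|hj] := ltnP j.+1 (size s).
  rewrite !ul; try lia.
  by move=> h1 h2; left; apply: sd ij hj h1 h2.
have [hi|hi] := ltnP i.+1 (size s).
  rewrite [j]split -?addnS; last by lia.
  rewrite !(ul _ hi) !(ul _ (ltnW hi)) !ur => h1 h2.
  have [||qe|[c q1 q2]] := meet q; [by exists i|by exists (j - (size s).-1)%N => //; lia| |].
    have j0 : (j - (size s).-1 = 0)%N by apply: simple_polyline_head ts _ _; rewrite -?qe //; lia.
    have i0 : i.+2 = size s by apply: simple_polyline_last ss _ _; rewrite ?st -?qe //; lia.
    by left; split; [lia|rewrite j0].
  have j0 : ((j - (size s).-1).+2 = size t)%N.
      by apply: simple_polyline_last ts _ _; rewrite -?q2 //; lia.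
  have i0 : i = 0%N by apply: simple_polyline_head ss _ _; rewrite -?q1 //; lia.
  by right; split=> //; rewrite ?ul //; lia.
rewrite [i]split; last by lia.
rewrite [j]split -?addnS ?ur; last by lia.
move=> h1 h2; left.
have [||] := td _ _ q _ _ h1 h2; try lia.
by move=> e1 e2; split=> //; lia.
Qed.

End Polylines.

(** * Triangles in a planar drawing *)

Section Joins.
Variable R : realType.
Implicit Types s t : seq (R * R).

Lemma join_last s t : (0 < size s)%N -> (0 < size t)%N ->
    s`_(size s).-1 = t`_0 -> (join s t)`_(size (join s t)).-1 = t`_(size t).-1.
Proof.
move=> s0 t0 st; rewrite size_join // -(nth_joinr (size t).-1 s0 st).
by congr nth; lia.
Qed.

Lemma join_first_step s t : (1 < size s)%N -> first_step (join s t) = first_step s.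
Proof. by move=> s1; rewrite /first_step !nth_joinl // ltnW. Qed.

Lemma join_last_step s t : (0 < size s)%N -> (1 < size t)%N ->
  s`_(size s).-1 = t`_0 -> last_step (join s t) = last_step t.
Proof.
move=> s0 t1 st; rewrite /last_step join_last // ?(ltnW t1) //; congr (_ - _).
rewrite size_join ?(ltnW t1) // -(nth_joinr (size t).-2 s0 st).
by congr nth; lia.
Qed.
Lemma join_octilinear_steps s t : (0 < size s)%N -> (0 < size t)%N ->
    s`_(size s).-1 = t`_0 -> octilinear_steps s -> octilinear_steps t ->
  octilinear_steps (join s t).
Proof.
move=> s0 t0 st os ot i; rewrite size_join // => iu.
have [h|h] := ltnP i.+1 (size s).
  by rewrite !nth_joinl ?(ltnW h) //; exact: os.
have -> : i = ((size s).-1 + (i - (size s).-1))%N by lia.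
by rewrite -addnS !nth_joinr //; apply: ot; lia.
Qed.
End Joins.

(** * Segments leaving a common point *)

Section Rays.
Variable R : realType.
Local Notation plane := (R * R)%type.
Implicit Types a b q n y : plane.
Local Open Scope classical_set_scope.

(** The midpoint is where [unbounded_on_left] looks. Half of the segment reaches it without touching
    the far end, which may lie on the polygon under consideration. *)
Lemma half_segment a b q : a != b -> segment a (a + 2^-1 *: (b - a)) q ->
  segment a b q /\ q != b.
Proof.
move=> ab /segmentP[t [t0 t1]].
have -> : (a.1 + t * ((a + 2^-1 *: (b - a)).1 - a.1),
           a.2 + t * ((a + 2^-1 *: (b - a)).2 - a.2)) =
          (a.1 + t / 2 * (b.1 - a.1), a.2 + t / 2 * (b.2 - a.2)) :> plane.
  by congr pair; rewrite /= /GRing.scale /=; ring.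
move=> ->; split.
  by apply/segmentP; exists (t / 2); split=> //; lra.
apply: contra ab; case: a b => [a1 a2] [b1 b2]; rewrite !xpair_eqE /= => /andP[/eqP e1 /eqP e2].
have h : 1 - t / 2 != 0 by rewrite gt_eqF; lra.
apply/andP; split; rewrite -subr_eq0 -(mulrI_eq0 _ (lregP h)); apply/eqP; lra.
Qed.

Lemma near_offset (P : set plane) y n : (\forall z \near y, P z) ->
  \forall eps \near (0 : R)^'+, P (y + eps *: n).
Proof.
move=> Py; have c : (fun e : R => y + e *: n) @ (0 : R)^'+ --> y.
  rewrite -[X in _ --> X]addr0 -[X in _ + X](scale0r n).
  apply: cvgD; first exact: cvg_cst.
  by apply: cvgZ; [apply: cvg_at_right_filter; exact: cvg_id|exact: cvg_cst].
exact: c.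
Qed.

Lemma same_direction_overlap y a b : a != 0 -> b != 0 ->
    cross a b = 0 -> 0 < dot a b ->
  exists q, [/\ q != y, segment y (y + a) q & segment y (y + b) q].
Proof.
move=> a0 b0 cr dt; have [e1 e2] := parallelP a0 cr.
have : 0 < dot a b / dot a a by rewrite divr_gt0 // dot_gt0.
move: (_ / _) e1 e2 => k e1 e2 k0.
have neq (c : plane) : c != 0 -> y + c != y.
  by rewrite -[y + c == y]subr_eq0 addrAC subrr add0r.
have [k1|k1] := lerP k 1.
  exists (y + b); split; [exact: neq| |exact: segmentr].
  apply/segmentP; exists k; split; rewrite ?(ltW k0) // [LHS]surjective_pairing.
  by congr pair => /=; rewrite ?e1 ?e2; ring.
exists (y + a); split; [exact: neq|exact: segmentr|].
have kk : k^-1 * k = 1 by rewrite mulVf // gt_eqF.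
apply/segmentP; exists k^-1; split; rewrite ?invr_ge0 ?(ltW k0) ?invf_le1 ?(ltW k1) //.
rewrite [LHS]surjective_pairing.
by congr pair => /=; rewrite ?e1 ?e2 addrAC subrr add0r mulrA kk mul1r.
Qed.
Lemma offset_cross y a b :
  (forall eps : R, cross a (y + 2^-1 *: a + eps *: (- a.2, a.1) - y) = eps * dot a a) /\
  (forall eps : R, cross (y + 2^-1 *: a + eps *: (- a.2, a.1) - y) b =
    cross a b / 2 - eps * dot a b).
Proof.
by case: y a b => [y1 y2] [a1 a2] [b1 b2]; split=> e;
  rewrite /cross /dot /= /GRing.scale /=; field.
Qed.
End Rays.

Section Triangles.
Variables (R : realType) (G : sgraph) (D : drawing R G).
Local Notation plane := (R * R)%type.
Implicit Types (u v w z : G) (a b f q x y : plane).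
Local Open Scope classical_set_scope.
Hypothesis planar : planar_drawing D.

Local Notation EP := (edge_points D).
Local Notation dir := (initial_direction D).

Lemma edge_neq u v : edge u v -> u != v.
Proof. by apply: contraTneq => ->; rewrite edge_irr. Qed.

Lemma size_edge_points u v : (1 < size (EP u v))%N.
Proof. by rewrite /= size_rcons. Qed.

Lemma edge_points_last u v : (EP u v)`_(size (EP u v)).-1 = pos D v.
Proof. by rewrite nth_last /= last_rcons. Qed.

Lemma edge_points_rev u v : edge u v -> EP v u = rev (EP u v).
Proof.
by move=> uv; rewrite /edge_points corners_sym // rev_cons rev_rcons rcons_cons.
Qed.

Lemma first_stepE u v : first_step (EP u v) = dir u v.
Proof. by []. Qed.

Lemma last_stepE u v : edge u v -> last_step (EP u v) = - dir v u.
Proof.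
move=> uv; have s1 := size_edge_points u v.
rewrite -first_stepE /first_step (edge_points_rev uv) !nth_rev ?(ltnW s1) //.
by rewrite opprB subn1 subn2.
Qed.

Lemma edge_simple u v : edge u v -> simple_polyline (EP u v).
Proof. by move=> uv; have [+ _ _] := planar; apply. Qed.

Lemma edge_octilinear_steps u v : octilinear_drawing D -> edge u v ->
  octilinear_steps (EP u v).
Proof.
move=> [_ oct] uv i iu; split; first exact: oct.
by rewrite subr_eq0 eq_sym; have [+ _] := edge_simple uv; apply.
Qed.

Definition triangle u v w : bool := [&& edge u v, edge v w & edge w u].

Definition boundary u v w : seq plane :=
  join (join (EP u v) (EP v w)) (EP w u).

Lemma size_boundary u v w :
  size (boundary u v w) = ((size (EP u v)).-1 + (size (EP v w)).-1 + size (EP w u))%N.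
Proof.
by rewrite !size_join // ?size_join //=; rewrite !size_rcons; lia.
Qed.

Lemma polyline_boundary u v w q : polyline (boundary u v w) q ->
  exists x y : G, [/\ (x, y) \in [:: (u, v); (v, w); (w, u)] & edge_curve D x y q].
Proof.
have s1 := size_edge_points; have j1 := edge_points_last u v.
move=> /polyline_join[|||/polyline_join[||||]|];
  rewrite ?join_last ?size_join ?edge_points_last ?addn_gt0 // => h.
- by exists u, v; rewrite !inE eqxx.
- by exists v, w; rewrite !inE eqxx orbT.
by exists w, u; rewrite !inE eqxx !orbT.
Qed.

Lemma edges_meet (a b c e : G) q : edge a b -> edge c e ->
    (a \notin [:: c; e]) || (b \notin [:: c; e]) ->
  edge_curve D a b q -> edge_curve D c e q ->
  exists x : G, [/\ x \in [:: a; b], x \in [:: c; e] & q = pos D x].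
Proof.
move=> ab ce ne h1 h2; have [_ _ +] := planar.
move=> /(_ a b c e q ab ce _ h1 h2)[|x [xa xc ->]].
  apply: contraTneq ne => E; rewrite negb_or !negbK !inE.
  by have := set21 a b; have := set22 a b; rewrite E !inE => -> ->.
by exists x; move: xa xc; rewrite !inE.
Qed.

Lemma initial_direction_neq0 u v : edge u v -> dir u v != 0.
Proof.
move=> uv; have [/(_ 0%N (size_edge_points u v)) + _] := edge_simple uv.
by rewrite eq_sym -subr_eq0.
Qed.

(** Otherwise the first segments of the two edges would overlap beyond [u]. *)
Lemma initial_direction_neq u v w : edge u v -> edge u w -> v != w ->
  ~ (cross (dir u v) (dir u w) = 0 /\ 0 < dot (dir u v) (dir u w)).
Proof.
move=> uv uw vw [cr dt].
have [q [qn h1 h2]] := same_direction_overlap (pos D u)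
  (initial_direction_neq0 uv) (initial_direction_neq0 uw) cr dt.
have {}h1 : edge_curve D u v q.
  by exists 0%N; [exact: size_edge_points|move: h1; rewrite addrC subrK].
have {}h2 : edge_curve D u w q.
  by exists 0%N; [exact: size_edge_points|move: h2; rewrite addrC subrK].
have [|x [xa xc qe]] := edges_meet uv uw _ h1 h2.
  by rewrite !inE [v == u]eq_sym (negbTE (edge_neq uv)) (negbTE vw) orbT.
move: xa xc qn; rewrite qe !inE => /orP[/eqP->|/eqP->]; first by rewrite !eqxx.
by rewrite [v == u]eq_sym (negbTE (edge_neq uv)) (negbTE vw).
Qed.

Lemma half_first_segment u v q : edge u v ->
    segment (pos D u) (pos D u + 2^-1 *: dir u v) q ->
  edge_curve D u v q /\ q != first_corner D u v.
Proof.
move=> uv; have := initial_direction_neq0 uv; rewrite subr_eq0 eq_sym => ne.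
move=> /(half_segment ne)[h ->]; split=> //.
by exists 0%N => //; exact: size_edge_points.
Qed.

Lemma half_first_segment_end u v : edge u v ->
  ~ segment (pos D u) (pos D u + 2^-1 *: dir u v) (pos D v).
Proof.
move=> uv /[dup] h /(half_first_segment uv)[_]; apply/negP; rewrite negbK.
have := initial_direction_neq0 uv; rewrite subr_eq0 eq_sym => /half_segment/(_ h)[].
rewrite -(edge_points_last u v) => h0 _; have s1 := size_edge_points u v.
have := simple_polyline_last (edge_simple uv) s1 h0.
by rewrite /first_corner => <-.
Qed.

Section Boundary.
Variables u v w : G.
Hypothesis tri : triangle u v w.
Local Notation C := (boundary u v w).
Local Notation p := (nth 0 (boundary u v w)).
Local Notation m := (size (boundary u v w)).-1.

Let uv : edge u v. Proof. by case/and3P: tri. Qed.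
Let vw : edge v w. Proof. by case/and3P: tri. Qed.
Let wu : edge w u. Proof. by case/and3P: tri. Qed.
Let nuv := edge_neq uv.
Let nvw := edge_neq vw.
Let nwu := edge_neq wu.

Let s1 := size_edge_points.
Let l := edge_points_last.

Let join_uv_vw : simple_polyline (join (EP u v) (EP v w)).
Proof.
have [|||||q h1 h2|A B] := @simple_join _ False (EP u v) (EP v w);
  rewrite ?l ?s1 //; try exact: edge_simple.
  have [|x []] := edges_meet uv vw _ h1 h2.
    by rewrite !inE (negbTE nuv) [u == w]eq_sym (negbTE nwu).
  rewrite !inE => /orP[/eqP->|/eqP-> _ ->]; last by left.
  by rewrite (negbTE nuv) [u == w]eq_sym (negbTE nwu).
by split=> // i j q ij jm h1 h2; have [|[]] := B i j q ij jm h1 h2.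
Qed.

Let join_last_uvw :
  (join (EP u v) (EP v w))`_(size (join (EP u v) (EP v w))).-1 = (EP w u)`_0.
Proof. by rewrite join_last // l. Qed.

Lemma boundary_last : p m = pos D u.
Proof. by rewrite join_last ?join_last_uvw ?l // size_join. Qed.

Lemma boundary_size : (2 < m)%N.
Proof.
rewrite size_boundary; have := s1 u v; have := s1 v w; have := s1 w u; lia.
Qed.

Lemma boundary_simple : simple_closed p m.
Proof.
have m2 := boundary_size.
have [|||||q|A B] := @simple_join _ True (join (EP u v) (EP v w)) (EP w u).
- exact: join_uv_vw.
- exact: edge_simple.
- by rewrite size_join //; have := s1 u v; lia.
- exact: s1.
- exact: join_last_uvw.
- move=> h1 h2; have {h1}h1 : edge_curve D u v q \/ edge_curve D v w q.
    by apply: polyline_join h1 => //; rewrite l.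
  case: h1 => h1.
    have [|x []] := edges_meet uv wu _ h1 h2.
      by rewrite !inE [v == u]eq_sym (negbTE nuv) (negbTE nvw) orbT.
    rewrite !inE => /orP[] /eqP -> /orP[] /eqP e ->.
    - by rewrite e; left.
    - by right; split; rewrite ?l.
    - by rewrite e; left.
    - by move: nuv; rewrite e eqxx.
  have [|x []] := edges_meet vw wu _ h1 h2.
    by rewrite !inE [v == u]eq_sym (negbTE nuv) (negbTE nvw).
  rewrite !inE => /orP[] /eqP -> ; last by left.
  by rewrite [v == u]eq_sym (negbTE nuv) (negbTE nvw).
split; first by rewrite boundary_last.
  by move=> i im; apply: A; rewrite -/C; lia.
move=> i j q ij jm h1 h2; have [||[_ i0 jm' qe]] := B i j q ij _ h1 h2.
- by rewrite -/C; lia.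
- by left.
by right; split=> //; rewrite -/C in jm'; lia.
Qed.

Lemma boundary_turning : octilinear_drawing D ->
  4 * turning p m =
  polyline_turning (EP u v) + polyline_turning (EP v w) + polyline_turning (EP w u)
  + eighth_turn (- dir v u) (dir v w) + eighth_turn (- dir w v) (dir w u)
  + eighth_turn (- dir u w) (dir u v).
Proof.
move=> oct; have m2 := boundary_size.
have o3 := edge_octilinear_steps oct.
rewrite closed_turning; first last.
- by rewrite boundary_last.
- by lia.
- apply: join_octilinear_steps; rewrite ?join_last_uvw ?size_join //; last exact: o3.
  by apply: join_octilinear_steps; rewrite ?l //; exact: o3.
rewrite polyline_turning_join ?join_last_uvw //; last first.
  by rewrite size_join // addnC; have := s1 u v; have := s1 v w; lia.
rewrite polyline_turning_join ?l // !join_last_step ?join_last_uvw ?size_join ?l //.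
have -> : first_step C = dir u v.
  rewrite join_first_step; first by rewrite join_first_step.
  by rewrite size_join //; have := s1 u v; lia.
by rewrite !last_stepE // !first_stepE; ring.
Qed.

Lemma boundary_meet (a b : G) q : edge a b ->
    (a \notin [:: u; v; w]) || (b \notin [:: u; v; w]) ->
    edge_curve D a b q -> polyline C q ->
  exists x : G, [/\ x \in [:: a; b], x \in [:: u; v; w] & q = pos D x].
Proof.
move=> ab ne h1 /polyline_boundary[c [e [ce h2]]].
have sub (x : G) : x \in [:: c; e] -> x \in [:: u; v; w].
  by move: ce; rewrite !inE !xpair_eqE => /or3P[]/andP[/eqP-> /eqP->] /orP[]->;
    rewrite ?orbT.
have ece : edge c e.
  by move: ce; rewrite !inE !xpair_eqE => /or3P[]/andP[/eqP-> /eqP->].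
have [|x [xa xc qe]] := edges_meet ab ece _ h1 h2.
  by case/orP: ne => ne; apply/orP; [left|right]; apply: contra ne; exact: sub.
by exists x; split=> //; exact: sub.
Qed.

Lemma boundary_segment i q : (i < m)%N -> segment (p i) (p i.+1) q -> polyline C q.
Proof. by move=> im h; exists i => //; lia. Qed.

Lemma fan_avoid x y : (forall q, segment x y q -> polyline C q -> False) ->
  fan p m x = fan p m y.
Proof.
move=> av; apply: fan_closed_shift; first by rewrite boundary_last.
move=> i im; apply: disjoint_segments_separated => q h1 h2.
by apply: (av q h1); exact: boundary_segment h2.
Qed.

(** Starting at the point [i] of the edge allows an edge that leaves a vertex of the triangle to be
    followed from its first corner on. *)
Lemma fan_along (a b : G) i : edge a b -> (i < size (EP a b))%N ->
    (forall k q, (i <= k)%N -> (k.+1 < size (EP a b))%N ->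
      segment (EP a b)`_k (EP a b)`_k.+1 q -> polyline C q -> False) ->
  fan p m (EP a b)`_i = fan p m (pos D b).
Proof.
move=> ab ib av; rewrite -(edge_points_last a b).
have : (i <= (size (EP a b)).-1)%N by lia.
have : ((size (EP a b)).-1 < size (EP a b))%N by have := s1 a b; lia.
elim: (size (EP a b)).-1 => [|k IHk] kb; first by rewrite leqn0 => /eqP->.
rewrite leq_eqVlt => /orP[/eqP->//|ik].
by rewrite IHk // ?(ltnW kb) //; apply: fan_avoid => q; exact: av.
Qed.

Lemma fan_edge (a b : G) : edge a b -> a \notin [:: u; v; w] -> b \notin [:: u; v; w] ->
  fan p m (pos D a) = fan p m (pos D b).
Proof.
move=> ab na nb; rewrite -[pos D a]/(EP a b)`_0; apply: fan_along => //.
move=> k q _ kb hk hq.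
have [||x [xa xc _]] := boundary_meet ab _ _ hq; [by rewrite na|by exists k|].
by move: xa xc; rewrite inE => /orP[/eqP->|]; rewrite ?(negbTE na) // inE => /eqP->; rewrite (negbTE nb).
Qed.

Lemma boundary_last_step : p m.-1 - p 0%N = dir u w.
Proof.
rewrite -[dir u w]opprK -last_stepE // -(join_last_step (s := join (EP u v) (EP v w))) //.
by rewrite [in RHS]/last_step opprB -/C boundary_last.
Qed.

Lemma boundary_penultimate : p m.-1 = first_corner D u w.
Proof. by apply: (addIr (- pos D u)); exact: boundary_last_step. Qed.

Lemma boundary_first_step : p 1%N - p 0%N = dir u v.
Proof.
rewrite -[LHS]/(first_step C) join_first_step; first by rewrite join_first_step.
by rewrite size_join //; have := s1 u v; lia.
Qed.

Lemma boundary_ccw x :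
    (forall i, (i.+2 < m)%N ->
      exists a, separates a (pos D u) x (p i.+1) (p i.+2)) ->
    fan p m x = 0 -> ccw (dir u w) (x - pos D u) (dir u v) ->
  turning p m = 2.
Proof.
have simp := boundary_simple; have := boundary_size.
have := boundary_last_step; have := boundary_first_step; have := boundary_last.
have p0 : p 0%N = pos D u by [].
rewrite -p0; move: simp; case: m => [|[|[|n]]] // simp pm <- <- _ sep fx o.
exact: (turning_ccw simp sep fx o).
Qed.

Lemma boundary_inner_start i : (i.+2 < m)%N -> ~ segment (p i.+1) (p i.+2) (pos D u).
Proof.
move=> im h; have [pm pn disj] := boundary_simple.
have [||[e1 e2]|[_ e _]] := disj 0%N i.+1 (p 0%N) _ _ (segmentl _ _) h.
- by [].
- by lia.
- by have := pn 0%N; rewrite {1}e2 e1 eqxx => /(_ (ltn_trans _ im)); lia.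
- by lia.
Qed.

(** The first corner of the edge [uz] serves as the point [x] of [turning_ccw]: it has the winding
    number of [z], because the edge does not meet the triangle again. *)
Lemma boundary_ccw_edge z : edge u z -> z \notin [:: u; v; w] ->
    fan p m (pos D z) = 0 -> ccw (dir u w) (dir u z) (dir u v) ->
  turning p m = 2.
Proof.
move=> uz nz fz o.
have only_u k q : (k.+1 < size (EP u z))%N ->
    segment (EP u z)`_k (EP u z)`_k.+1 q -> polyline C q -> q = pos D u.
  move=> kz hk hq; have [||x [xa xc ->]] := boundary_meet uz _ _ hq.
  - by rewrite nz orbT.
  - by exists k.
  by move: xa; rewrite !inE => /orP[]/eqP e; rewrite ?e //; rewrite e (negbTE nz) in xc.
apply: (boundary_ccw (x := first_corner D u z)) o.
  move=> i im; apply: disjoint_segments_separated => q h1 h2.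
  apply: (boundary_inner_start im).
  have <- // : q = pos D u.
  apply: (only_u 0%N) h1 _; first exact: s1.
  by apply: boundary_segment h2; lia.
rewrite /first_corner fan_along // => k q k1 kz hk hq.
have qu := only_u k q kz hk hq; rewrite qu in hk.
have := simple_polyline_head (edge_simple uz) kz hk; lia.
Qed.

(** The points just left of the midpoint of the first segment lie in an unbounded component, where
    the winding number is 0. Half of that segment joins [z] to the midpoint and avoids the triangle,
    even if [z'] is a vertex of it. *)
Lemma fan_outer z z' : edge z z' -> z \notin [:: u; v; w] ->
  unbounded_on_left D z z' -> fan p m (pos D z) = 0.
Proof.
move=> zz' nz unb; set n := (- (dir z z').2, (dir z z').1).
pose mid := pos D z + 2^-1 *: dir z z'.
have av q : segment (pos D z) mid q -> polyline C q -> False.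
  move=> h hq; have [h1 _] := half_first_segment zz' h.
  have [|x [xa xc qe]] := boundary_meet zz' _ h1 hq; first by rewrite nz.
  move: xa; rewrite !inE => /orP[]/eqP e; first by rewrite e (negbTE nz) in xc.
  by apply: (half_first_segment_end zz'); have <- : q = pos D z' by rewrite qe e.
rewrite (fan_avoid av).
have nm : \forall y \near mid, fan p m mid = fan p m y.
  apply: near_fan; first by rewrite boundary_last.
  by move=> i im h; apply: (av mid); [exact: segmentr|exact: boundary_segment h].
have [e [-> [nd nb]]] := @filter_ex _ _ _ _ (filterI (near_offset n nm) unb).
apply: fan_unbounded_component nd nb; first by rewrite boundary_last.
move=> i im q h; right.
have [a [b [ab hq]]] := polyline_boundary (boundary_segment im h).
exists a, b; split=> //.
by move: ab; rewrite !inE !xpair_eqE => /or3P[]/andP[/eqP-> /eqP->].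
Qed.

(** Handles a triangle from which no edge goes outward. The point [x] is taken in the unbounded
    region, just left of the midpoint of the first segment of [uw]; seen from [u] it is slightly
    counterclockwise of [uw], hence reached before [uv]. *)
Lemma boundary_ccw_outer : unbounded_on_left D u w -> turning p m = 2.
Proof.
have uw : edge u w by rewrite edge_sym.
set a := dir u w; set n := (- a.2, a.1); move=> unb.
have a0 : a != 0 := initial_direction_neq0 uw.
have aa := dot_gt0 a0.
pose mid := pos D u + 2^-1 *: a.
have simp := boundary_simple; have [pm pn disj] := simp.
have m2 := boundary_size.
have n1 : \forall y \near mid, forall i, (i < m.-2)%N ->
    exists b, separates b (pos D u) y (p i.+1) (p i.+2).
  apply: (@near_lt _ (nbhs mid) _ m.-2 (fun i y => exists b, separates b (pos D u) y (p i.+1) (p i.+2))).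
  move=> i im; apply: near_separates => q h1 h2.
  have := initial_direction_neq0 uw; rewrite subr_eq0 eq_sym => /half_segment/(_ h1)[h3 qn].
  have ml : m.-1.+1 = m by rewrite prednK // (ltn_trans _ m2).
  have i1 : (i.+1 < m.-1)%N by clear -im; case: (size C).-1 im => [|[|k]].
  have i2 : (m.-1 < m)%N by rewrite ml.
  have h4 : segment (p m.-1) (p m.-1.+1) q.
    by rewrite ml boundary_last segment_sym boundary_penultimate.
  have [[e1 e2]|[//]] := disj i.+1 m.-1 q i1 i2 h2 h4.
  by rewrite e2 boundary_penultimate eqxx in qn.
have n2 : \forall eps \near (0 : R)^'+, ccw a (mid + eps *: n - pos D u) (dir u v).
  pose f := dir u v.
  have [e1 e2] := offset_cross (pos D u) a f.
  have nf : 0 < cross a f -> \forall y \near mid, 0 < cross (y - pos D u) f.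
    have w_ y : cross (y - pos D u) f = dot (- f.2, f.1) (pos D u - y).
      by rewrite /cross /dot /=; ring.
    move=> h; have m0 : 0 < dot (- f.2, f.1) (pos D u - mid).
      by rewrite -w_; have := e2 0; rewrite scale0r addr0 mul0r subr0 => ->; rewrite divr_gt0.
    have nn : \forall y \near mid, 0 < dot (- f.2, f.1) (pos D u - y).
      exact: (cvgr_gt _ (@dot_cvg _ (- f.2, f.1) (pos D u) mid)).
    by apply: filterS nn => y; rewrite w_.
  (* If [f] is parallel to [a] then it is opposite to [a], since two edges do not leave [u] in the
     same direction. *)
  rewrite /ccw; case: (ltgtP (cross a f) 0) => h.
  - near=> eps; have eps0 : 0 < eps by near: eps; exact: nbhs_right_gt.
    by rewrite e1 [cross (dir u v) a]crossN oppr_gt0 h mulr_gt0 ?orbT.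
  - near=> eps; have eps0 : 0 < eps by near: eps; exact: nbhs_right_gt.
    rewrite e1 mulr_gt0 //=; apply/orP; left; near: eps.
    exact: (near_offset n (nf h)).
  near=> eps; have eps0 : 0 < eps by near: eps; exact: nbhs_right_gt.
  rewrite e1 e2 h mul0r sub0r mulr_gt0 //= oppr_gt0 pmulr_rlt0 //.
  rewrite ltNge le_eqVlt negb_or; apply/orP; left; apply/andP; split; last first.
    apply/negP => dt; apply: (initial_direction_neq uw uv _ (conj h dt)).
    by rewrite eq_sym.
  rewrite eq_sym; apply/eqP => dt; have := mulr_gt0 aa (dot_gt0 (initial_direction_neq0 uv)).
  have -> : dot a a * dot f f = dot a f ^+ 2 + cross a f ^+ 2 by rewrite /dot /cross; ring.
  by rewrite dt h expr0n /= addr0 ltxx.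
have [e [[e1 e2] [nd nb]]] := @filter_ex _ _ _ _ (filterI (filterI (near_offset n n1) n2) unb).
apply: (@boundary_ccw (mid + e *: n)) => //.
  by move=> i im; apply: e1; clear -im; case: (size C).-1 im => [|[|k]].
apply: fan_unbounded_component nd nb; first by rewrite boundary_last.
move=> i im q h; right.
have [b [c [bc hq]]] := polyline_boundary (boundary_segment im h).
exists b, c; split=> //.
by move: bc; rewrite !inE !xpair_eqE => /or3P[]/andP[/eqP-> /eqP->].
Unshelve. all: end_near. Qed.

End Boundary.
End Triangles.

(** * Nested triangles *)

Section Rotation.
Variable T : finType.
Implicit Types (s : seq T) (x y : T).

Lemma next_inj s : uniq s -> injective (next s).
Proof. by move=> us; exact: can_inj (prev_next us). Qed.

Definition next_perm s (us : uniq s) : {perm T} := perm (next_inj us).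

Lemma porbit_next_perm s (us : uniq s) x : x \in s ->
  porbit (next_perm us) x = [set y in s]%SET.
Proof.
move=> xs; apply/setP => y; rewrite inE -(fconnect_cycle (cycle_next us) xs).
have E i : ((next_perm us) ^+ i)%g x = iter i (next s) x.
  by rewrite permX; apply: eq_iter => z; rewrite permE.
apply/porbitP/idP => [[i ->]|h]; first by rewrite E fconnect_iter.
by exists (findex (next s) x y); rewrite E iter_findex.
Qed.

Lemma next_mid s1 x y s2 : uniq (s1 ++ x :: y :: s2) ->
  next (s1 ++ x :: y :: s2) x = y.
Proof.
move=> us; rewrite next_nth mem_cat mem_head orbT.
have xs : x \notin s1.
  by move: us; rewrite cat_uniq => /and3P[_ + _]; rewrite /= negb_or => /andP[].
case: s1 xs {us} => [|z s1] /= xs; first by rewrite eqxx.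
rewrite inE in xs; move: xs; rewrite negb_or eq_sym => /andP[/negbTE-> xs].
by rewrite index_cat (negbTE xs) /= eqxx addn0 nth_cat ltnNge leqnSn /= subSnn.
Qed.

Lemma next_end x s y : uniq (x :: rcons s y) -> next (x :: rcons s y) y = x.
Proof.
rewrite -rcons_cons rcons_uniq => /andP[yn _].
rewrite next_nth mem_rcons mem_head rcons_cons nth_default //.
by rewrite -rcons_cons -[rcons (x :: s) y]cats1 index_cat (negbTE yn) /= eqxx addn0 size_rcons.
Qed.
End Rotation.

Section NestedTriangles.
Variables (n : nat) (dg : nat -> bool).
Local Notation L := n.+2.
Local Notation V := ('I_n.+2 * 'I_3)%type.
Implicit Types (v : V) (l : nat).

(* Triangle 0 is the outermost one.  The labels 0, ..., 5 list the neighbours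
   counterclockwise: 0 and 3 are spokes, 2 and 5 are diagonals. *)
Definition target v l : V :=
  match l with
  | 0 => (inord v.1.-1, v.2)
  | 1 => (v.1, v.2 + 1)
  | 2 => (inord v.1.+1, v.2 + 1)
  | 3 => (inord v.1.+1, v.2)
  | 4 => (v.1, v.2 - 1)
  | _ => (inord v.1.-1, v.2 - 1)
  end.

Definition present v l : bool :=
  match l with
  | 0 => (0 < v.1)%N
  | 1 => true
  | 2 => (v.1.+1 < L)%N && dg v.1
  | 3 => (v.1.+1 < L)%N
  | 4 => true
  | _ => (0 < v.1)%N && dg v.1.-1
  end.

Definition labels v : seq nat := [seq l <- iota 0 6 | present v l].
Definition nbrs v : seq V := [seq target v l | l <- labels v].

Definition opposite l : nat := nth 0%N [:: 3; 4; 5; 0; 1; 2]%N l.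

Lemma nbrsP v u :
  reflect (exists l, [/\ (l < 6)%N, present v l & u = target v l]) (u \in nbrs v).
Proof.
apply: (iffP mapP) => [[l]|[l [l6 pl ->]]].
  by rewrite mem_filter mem_iota => /andP[pl /= l6] ->; exists l.
by exists l => //; rewrite mem_filter mem_iota pl.
Qed.

Lemma target_layer v l : (l < 6)%N -> present v l ->
  (target v l).1 = nth 0%N [:: v.1.-1; v.1 : nat; v.1.+1; v.1.+1; v.1 : nat; v.1.-1] l :> nat.
Proof.
case: v => i j; have iL := ltn_ord i.
case: l => [|[|[|[|[|[|//]]]]]] _ //= pl; rewrite ?inordK //;
  by [case/andP: pl|lia].
Qed.

Lemma target_opposite v l : (l < 6)%N -> present v l ->
  [/\ (opposite l < 6)%N, present (target v l) (opposite l)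
    & target (target v l) (opposite l) = v].
Proof.
move=> l6 pl; have E := target_layer l6 pl; split.
  by case: l l6 {pl E} => [|[|[|[|[|[|//]]]]]].
  case: v pl E => i j; have iL := ltn_ord i.
  case: l l6 => [|[|[|[|[|[|//]]]]]] _ //= + ->; [lia|case/andP=> h ->|lia|case/andP=> h e].
    by rewrite andbT.
  by rewrite prednK // e andbT.
case: v pl E => i j; have iL := ltn_ord i.
case: l l6 => [|[|[|[|[|[|//]]]]]] _ /= pl E; rewrite ?E ?addrK ?subrK //; congr pair;
 apply: val_inj; rewrite /= inordK //; lia.
Qed.

Lemma ord3_neq (j : 'I_3) : [/\ j + 1 != j, j - 1 != j & j + 1 != j - 1].
Proof. by case: j => [[|[|[|//]]] ?]; split. Qed.

Lemma target_irr v l : (l < 6)%N -> present v l -> target v l != v.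
Proof.
move=> l6 pl; have := target_layer l6 pl; case: v pl => i j; have iL := ltn_ord i.
have [e1 e2 _] := ord3_neq j.
case: l l6 => [|[|[|[|[|[|//]]]]]] _ /= pl E;
 rewrite xpair_eqE ?eqxx ?(negbTE e1) ?(negbTE e2) ?andbF ?andbT //;
 apply: contraTneq pl => h; rewrite h in E; lia.
Qed.

Lemma target_inj v l l' : (l < 6)%N -> present v l -> (l' < 6)%N -> present v l' ->
  target v l = target v l' -> l = l'.
Proof.
move=> l6 pl l6' pl' e.
have := target_layer l6 pl; rewrite e target_layer //.
move: e => /eqP; case: v pl pl' => i j; have [e1 e2 e3] := ord3_neq j.
case: l l6 => [|[|[|[|[|[|//]]]]]] _; case: l' l6' => [|[|[|[|[|[|//]]]]]] _ //= pl pl';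
  rewrite !xpair_eqE;
  try (by move=> _ E; exfalso; lia); case/andP=> _;
  rewrite ?(negbTE e3) ?(negbTE e1) ?(negbTE e2) 1?eq_sym;
  rewrite ?(negbTE e3) ?(negbTE e1) ?(negbTE e2) //.
Qed.

Lemma nbrs_uniq v : uniq (nbrs v).
Proof.
rewrite map_inj_in_uniq ?filter_uniq ?iota_uniq // => l l'.
rewrite !mem_filter !mem_iota => /andP[pl l6] /andP[pl' l6']; exact: target_inj.
Qed.

Definition nt_edge : rel V := fun u v => v \in nbrs u.

Lemma nt_edge_sym : symmetric nt_edge.
Proof.
suff S u v : nt_edge u v -> nt_edge v u by move=> u v; apply/idP/idP; exact: S.
move=> /nbrsP[l [l6 pl ->]]; apply/nbrsP; have [h6 po e] := target_opposite l6 pl.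
by exists (opposite l).
Qed.

Lemma nt_edge_irr : irreflexive nt_edge.
Proof.
move=> v; apply/negbTE/nbrsP => -[l [l6 pl e]].
by have := target_irr l6 pl; rewrite -e eqxx.
Qed.

Definition nt_graph := SGraph nt_edge_sym nt_edge_irr.

Lemma nt_rotP (v u : nt_graph) : edge v u ->
  porbit (next_perm (nbrs_uniq v)) u = [set w | edge v w]%SET.
Proof. exact: porbit_next_perm. Qed.

Lemma nt_degree v : #|[set u : nt_graph | edge (v : nt_graph) u]%SET| = size (labels v).
Proof.
rewrite -[RHS](size_map (target v)) -(card_uniqP (nbrs_uniq v)).
by apply: eq_card => u; rewrite inE.
Qed.

Definition nt_rot v : {perm V} := next_perm (nbrs_uniq v).

Lemma nt_rot_mid v l l' s1 s2 : labels v = s1 ++ l :: l' :: s2 ->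
  nt_rot v (target v l) = target v l'.
Proof.
move=> e; have := nbrs_uniq v; rewrite /nt_rot permE /nbrs e map_cat /=.
exact: next_mid.
Qed.

Lemma nt_rot01 v : (0 < v.1)%N -> nt_rot v (target v 0) = target v 1.
Proof.
by move=> i0; apply: (@nt_rot_mid _ _ _ [::] [seq l <- iota 2 4 | present v l]);
  rewrite /labels /= i0.
Qed.

Let before v l : seq nat := [seq l <- iota 0 l | present v l].

Lemma nt_rot12 v : (v.1.+1 < L)%N -> dg v.1 -> nt_rot v (target v 1) = target v 2.
Proof.
move=> iL d; apply: (@nt_rot_mid _ _ _ (before v 1) [seq l <- iota 3 3 | present v l]).
by rewrite /before /labels /= iL d; case: (0 < v.1)%N.
Qed.

Lemma nt_rot23 v : (v.1.+1 < L)%N -> dg v.1 -> nt_rot v (target v 2) = target v 3.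
Proof.
move=> iL d; apply: (@nt_rot_mid _ _ _ (before v 2) [seq l <- iota 4 2 | present v l]).
by rewrite /before /labels /= iL d; case: (0 < v.1)%N.
Qed.

Lemma nt_rot13 v : (v.1.+1 < L)%N -> ~~ dg v.1 -> nt_rot v (target v 1) = target v 3.
Proof.
move=> iL d; apply: (@nt_rot_mid _ _ _ (before v 1) [seq l <- iota 4 2 | present v l]).
by rewrite /before /labels /= iL (negbTE d); case: (0 < v.1)%N.
Qed.

Lemma nt_rot34 v : (v.1.+1 < L)%N -> nt_rot v (target v 3) = target v 4.
Proof.
move=> iL; apply: (@nt_rot_mid _ _ _ (before v 3) [seq l <- iota 5 1 | present v l]).
by rewrite /before /labels /= iL; case: (0 < v.1)%N; case: (dg v.1).
Qed.

Lemma nt_rot41 v : v.1 = 0%N :> nat -> nt_rot v (target v 4) = target v 1.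
Proof.
move=> i0; rewrite /nt_rot permE; have := nbrs_uniq v.
have -> : nbrs v = target v 1 :: rcons [seq target v l | l <- iota 2 2 & present v l] (target v 4).
  by rewrite /nbrs /labels /= i0 /=; case: (dg 0).
exact: next_end.
Qed.

(** The triangle 0 is traversed clockwise, so that the outer face is on the left. *)
Definition outer_dart (j : 'I_3) : V * V := ((ord0, j + 1), (ord0, j)).

Definition nt_outer : {set V * V} := face_of nt_rot (outer_dart 0).

Lemma mem_nt_outer d : d \in nt_outer = (d \in [seq outer_dart j | j <- enum 'I_3]).
Proof.
have F j : face_next nt_rot (outer_dart j) = outer_dart (j - 1).
  rewrite /face_next /outer_dart /= subrK; congr pair; apply: (canLR (permK _)).
  by rewrite -[LHS]/(target (ord0, j) 1) -nt_rot41.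
pose s := [:: outer_dart 0; outer_dart (- 1); outer_dart (- 1 - 1)].
have cs : fcycle (face_next nt_rot) s.
  by rewrite /= !F sub0r !eqxx.
rewrite inE (fconnect_cycle cs) ?mem_head // /s.
apply/idP/mapP => [|[j _ ->]].
  by rewrite !inE => /or3P[] /eqP ->; eexists => //; rewrite mem_enum.
by case: j => [[|[|[|//]]] h]; rewrite !inE; apply/or3P;
  [constructor 1|constructor 3|constructor 2]; apply/eqP; congr outer_dart; exact: val_inj.
Qed.

Lemma nt_outerP : exists2 d : nt_graph * nt_graph, edge d.1 d.2 &
  nt_outer = face_of nt_rot d.
Proof.
exists (outer_dart 0) => //; apply/nbrsP; exists 4%N; split=> //.
by congr pair; apply: val_inj.
Qed.

Definition nested_triangles : embedded_graph :=
  @EmbeddedGraph nt_graph nt_rot nt_rotP nt_outer nt_outerP.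

Lemma card_nested_triangles : #|nested_triangles| = (3 * L)%N.
Proof. by rewrite card_prod !card_ord mulnC. Qed.

Lemma ring_edge (i : 'I_L) (j j' : 'I_3) : j != j' -> nt_edge (i, j) (i, j').
Proof.
move=> jj; apply/nbrsP.
have : (j' == j + 1) || (j' == j - 1).
  by move: jj; case: j => [[|[|[|//]]] h]; case: j' => [[|[|[|//]]] h'].
by case/orP=> /eqP ->; [exists 1%N|exists 4%N].
Qed.

(* Each column of spokes and each triangle is connected, and two deleted
   vertices leave some column intact. *)
Lemma nested_triangles_triconnected : triconnected nested_triangles.
Proof.
split; first by rewrite card_nested_triangles; lia.
move=> S S3 u v uS vS; set e := (X in connect X).
have es : connect_sym e.
  apply: sym_connect_sym => x y; rewrite /e /=.
  by congr (_ && _); [exact: edge_sym|exact: andbC].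
have [j jS] : exists j : 'I_3, forall i, (i, j) \notin S.
  have : ~~ ([set: 'I_3] \subset [set x.2 | x in S])%SET.
    apply: contraTN S3 => /subset_leq_card; rewrite cardsT card_ord -leqNgt => h.
    exact: leq_trans h (leq_imset_card _ _).
  case/subsetPn => j _ jn; exists j => i; apply: contra jn => h.
  by apply/imsetP; exists (i, j).
have column (i : 'I_L) : connect e (ord0, j) (i, j).
  case: i => i; elim: i => [|i IHi] iL; first by rewrite (_ : Ordinal iL = ord0) //; exact: val_inj.
  apply: connect_trans (IHi (ltnW iL)) _; apply: connect1; rewrite /e /= !jS !andbT.
  apply/nbrsP; exists 3%N; split=> //; congr pair.
  by apply: val_inj; rewrite /= inordK.
have to_column x : x \notin S -> connect e (ord0, j) x.
  case: x => i j' xS; apply: connect_trans (column i) _.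
  have [->//|jj] := eqVneq j' j.
  by apply: connect1; rewrite /e /= jS xS !andbT; apply: ring_edge; rewrite eq_sym.
by apply: connect_trans (to_column v vS); rewrite es; exact: to_column.
Qed.

Lemma nested_triangles_degree k : (forall v, (size (labels v) <= k)%N) ->
  max_degree_le k nested_triangles.
Proof. by move=> h v; rewrite nt_degree. Qed.

End NestedTriangles.

(** * A straight-line drawing *)

Section StraightLine.
Variables (R : realType) (n : nat) (dg : nat -> bool).
Local Notation L := n.+2.
Local Notation V := ('I_n.+2 * 'I_3)%type.
Local Notation plane := (R * R)%type.
Local Notation target := (@target n).
Local Notation present := (@present n dg).
Implicit Types (v x y : V) (l : nat) (q : plane) (s : 'I_3).
Local Open Scope classical_set_scope.

(** The three vectors have sum 0 and consecutive ones have cross product 1. Hence the linear map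
    sending each to the next preserves [cross] and permutes the three sectors, which makes all
    formulas in sector coordinates independent of [s]. *)
Definition corner s : plane := nth 0 [:: (1, 0); (0, 1); (-1, -1)] s.

Lemma cornersP s :
  [\/ [/\ corner s = (1, 0), corner (s + 1) = (0, 1) & corner (s - 1) = (-1, -1)],
      [/\ corner s = (0, 1), corner (s + 1) = (-1, -1) & corner (s - 1) = (1, 0)]
    | [/\ corner s = (-1, -1), corner (s + 1) = (1, 0) & corner (s - 1) = (0, 1)]].
Proof.
by case: s => [[|[|[|//]]] h]; [constructor 1|constructor 2|constructor 3].
Qed.

Definition sector s (a b : R) : plane :=
  (a * (corner s).1 + b * (corner (s + 1)).1, a * (corner s).2 + b * (corner (s + 1)).2).

Lemma sector_inj s a b a' b' : sector s a b = sector s a' b' -> a = a' /\ b = b'.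
Proof.
by rewrite /sector; case: (cornersP s) => -[-> -> _] [] /=; lra.
Qed.

Lemma ord3_cases s s' : [\/ s' = s, s' = s + 1 | s = s' + 1].
Proof.
case: s => [[|[|[|//]]] h]; case: s' => [[|[|[|//]]] h'];
 solve [by constructor 1; apply: val_inj|by constructor 2; apply: val_inj
       |by constructor 3; apply: val_inj].
Qed.

Lemma sector_next s a b : sector (s + 1) a b = sector s (- b) (a - b).
Proof.
have E : s + 1 + 1 = s - 1 by apply: val_inj; case: s => [[|[|[|//]]] h].
by rewrite /sector E; case: (cornersP s) => -[-> -> ->] /=; congr pair; ring.
Qed.

(** A form of polar coordinates: [a + b] is a radius whose level curves are triangles, and two
    sectors meet only in their common ray. *)
Lemma sector_unique s s' a b a' b' :
    0 <= a -> 0 <= b -> 0 <= a' -> 0 <= b' -> sector s a b = sector s' a' b' ->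
  a + b = a' + b' /\
  [\/ [/\ s' = s, a = a' & b = b'], [/\ s' = s + 1, a = 0, b' = 0 & b = a']
    | [/\ s = s' + 1, a' = 0, b = 0 & a = b']].
Proof.
move=> a0 b0 a0' b0'; have [->|->|->] := ord3_cases s s'.
- by move/sector_inj => [-> ->]; split=> //; constructor 1.
- rewrite sector_next => /sector_inj[e1 e2]; split; first lra.
  by constructor 2; split=> //; lra.
rewrite sector_next => /sector_inj[e1 e2]; split; first lra.
by constructor 3; split=> //; lra.
Qed.

Definition level v : nat := (L - v.1)%N.

Lemma level_gt0 v : (0 < level v)%N.
Proof. by rewrite subn_gt0. Qed.

Lemma level_inj v x : level v = level x -> v.1 = x.1.
Proof.
move=> e; apply: val_inj => /=; have := ltn_ord v.1; have := ltn_ord x.1.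
by rewrite /level in e; lia.
Qed.

Definition sl_pos v : plane := sector v.2 (level v)%:R 0.

Lemma level_ge1 v : 1 <= (level v)%:R :> R.
Proof. by rewrite ler1n level_gt0. Qed.

Lemma sl_pos_inj : injective sl_pos.
Proof.
move=> v x /sector_unique[]; rewrite ?ler0n // !addr0 => /eqP.
rewrite eqr_nat => /eqP/level_inj e h; have := level_ge1 v; have := level_ge1 x.
case: v x e h => i j [i' j'] /= -> [[-> //]|[_ -> _ _]|[_ -> _ _]] h1 h2; exfalso; lra.
Qed.

Definition straight_line : drawing R (nt_graph n dg) :=
  @Drawing R (nt_graph n dg) sl_pos (fun _ _ => [::]) sl_pos_inj (fun _ _ _ => erefl).

Lemma straight_curve v x q : edge_curve straight_line v x q <-> segment (sl_pos v) (sl_pos x) q.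
Proof.
split=> [[[|i]] //|h]; by exists 0%N.
Qed.

(** One label of each opposite pair, so that every edge is described from exactly one end: sides of
    triangles counterclockwise, spokes and diagonals outward. *)
Definition forward l : bool := l \in [:: 0; 1; 5]%N.

Lemma forward_edge v x : nt_edge dg v x -> exists y l,
  [/\ present y l, forward l & (v, x) = (y, target y l) \/ (x, v) = (y, target y l)].
Proof.
move=> /nbrsP[l [l6 pl ->]]; have [fl|nf] := boolP (forward l).
  by exists v, l; split=> //; left.
have [h6 po e] := target_opposite l6 pl.
exists (target v l), (opposite l); split=> //; last by right; rewrite e.
by case: l l6 nf {pl h6 po e} => [|[|[|[|[|[|]]]]]].
Qed.

(** The edge is parametrised inside a sector that contains it; the default case stands for the label
    5, a diagonal in the sector clockwise from [y]. *)
Definition arc (y : V) l (t : R) : plane :=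
  let r := (level y)%:R in
  match l with
  | 0 => sector y.2 (r + t) 0
  | 1 => sector y.2 ((1 - t) * r) (t * r)
  | _ => sector (y.2 - 1) (t * (r + 1)) ((1 - t) * r)
  end.

Lemma level_outward y s : (0 < y.1)%N -> level (inord y.1.-1, s) = (level y).+1.
Proof.
case: y => [[i iL] j] /= i0; rewrite /level /= inordK; first by lia.
by rewrite (leq_ltn_trans (leq_pred i)).
Qed.

Lemma arcP y l q : present y l -> forward l ->
  segment (sl_pos y) (sl_pos (target y l)) q -> exists t, [/\ 0 <= t, t <= 1 & q = arc y l t].
Proof.
move=> pl fl /segmentP[t [t0 t1 ->]]; exists t; split=> //.
have E : y.2 - 1 + 1 = y.2 by rewrite subrK.
rewrite /sl_pos; case: l pl fl => [|[|[|[|[|[|//]]]]]] //= pl _; rewrite /arc /sector /=.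
- rewrite -/(level _) level_outward // -natr1; congr pair; ring.
- by rewrite /level /=; congr pair; ring.
case/andP: pl => y0 _; rewrite level_outward //.
by rewrite E -natr1; congr pair; ring.
Qed.

Lemma arc0 y l : forward l -> arc y l 0 = sl_pos y.
Proof.
have E : y.2 - 1 + 1 = y.2 by rewrite subrK.
by case: l => [|[|[|[|[|[|//]]]]]] // _; rewrite /arc /sl_pos /sector ?E;
  congr pair; ring.
Qed.

Lemma arc1 y l : present y l -> forward l -> arc y l 1 = sl_pos (target y l).
Proof.
case: l => [|[|[|[|[|[|//]]]]]] //= pl _; rewrite /arc /sl_pos /sector /=.
- by rewrite level_outward // -natr1; congr pair; ring.
- by rewrite /level /=; congr pair; ring.
by case/andP: pl => y0 _; rewrite level_outward // -natr1; congr pair; ring.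
Qed.

Definition arc_height l (t : R) : R := if l == 1%N then 0 else t.

Definition arc_sector y l : 'I_3 := if l == 5%N then y.2 - 1 else y.2.

Lemma arc_coords y l (t : R) : forward l -> 0 <= t -> t <= 1 -> exists a b,
  [/\ arc y l t = sector (arc_sector y l) a b, 0 <= a, 0 <= b,
      a + b = (level y)%:R + arc_height l t &
      [/\ (0 < t -> t < 1 -> 0 < a), (l = 0%N -> b = 0) & (l <> 0%N -> 0 < t -> t < 1 -> 0 < b)]].
Proof.
have r1 := level_ge1 y.
case: l => [|[|[|[|[|[|//]]]]]] //= _ t0 t1; rewrite /arc /arc_sector /arc_height /=.
- by exists ((level y)%:R + t), 0; do ?split=> //; lra.
- exists ((1 - t) * (level y)%:R), (t * (level y)%:R).
  by do ?split=> //; intros; nra.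
exists (t * ((level y)%:R + 1)), ((1 - t) * (level y)%:R).
by do ?split=> //; intros; nra.
Qed.

Lemma nat_steps (a b : nat) (s t : R) : 0 <= s -> s <= 1 -> 0 <= t -> t <= 1 ->
    a%:R + s = b%:R + t ->
  [\/ a = b /\ s = t, s = 1 /\ t = 0 | s = 0 /\ t = 1].
Proof.
move=> s0 s1 t0 t1 e; case: (ltngtP a b) => ab.
- constructor 2; have : a.+1%:R <= b%:R :> R by rewrite ler_nat.
  by rewrite -natr1; lra.
- constructor 3; have : b.+1%:R <= a%:R :> R by rewrite ler_nat.
  by rewrite -natr1; lra.
by constructor 1; split=> //; rewrite ab in e; lra.
Qed.

(** A vertex has integral radius and lies on a ray between sectors. Inside a spoke or a diagonal the
    radius is not integral, and the inside of a triangle side lies in an open sector. *)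
Lemma arc_endpoint y l (t : R) v : present y l -> forward l -> 0 <= t -> t <= 1 ->
  arc y l t = sl_pos v -> v = y \/ v = target y l.
Proof.
move=> pl fl t0 t1 e.
have [h|tn0] := eqVneq t 0.
  by move: e; rewrite h arc0 // => /sl_pos_inj ->; left.
have [h|tn1] := eqVneq t 1.
  by move: e; rewrite h arc1 // => /sl_pos_inj ->; right.
have tp : 0 < t by rewrite lt_def tn0.
have tl : t < 1 by rewrite lt_neqAle tn1.
have v1 := level_ge1 v.
have [a [b [E a0 b0 ab [ap b0' bp]]]] := arc_coords y fl t0 t1.
have [|||||sm U] := @sector_unique (arc_sector y l) v.2 a b (level v)%:R 0; rewrite -?E //.
exfalso; rewrite ab addr0 /arc_height in sm.
have [l1|l1] := eqVneq l 1%N.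
  have {}bp : 0 < b by apply: bp => //; rewrite l1.
  have {}ap := ap tp tl.
  by case: U => -[_ h1 h2]; lra.
rewrite (negbTE l1) -[RHS]addr0 in sm.
by clear -sm tp tl; have [||||[_ h]|[h _]|[h _]] := nat_steps _ _ _ _ sm; lra.
Qed.

(** The radius determines the level of the start and whether the arc is a side of a triangle; the
    sector, and whether the point lies on its first ray, determine the rest. *)
Lemma arcs_meet y l (t : R) y' l' (t' : R) : forward l -> forward l' ->
  0 < t -> t < 1 -> 0 < t' -> t' < 1 ->
  arc y l t = arc y' l' t' -> y = y' /\ l = l'.
Proof.
move=> fl fl' t0 t1 t0' t1' e.
have [a [b [E a0 b0 ab [ap bz bp]]]] := arc_coords y fl (ltW t0) (ltW t1).
have [a' [b' [E' a0' b0' ab' [ap' bz' bp']]]] := arc_coords y' fl' (ltW t0') (ltW t1').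
rewrite E E' in e; have [sm U] := sector_unique a0 b0 a0' b0' e.
rewrite ab ab' in sm; have {}ap := ap t0 t1; have {}ap' := ap' t0' t1'.
have H1 k (u : R) : 0 < u -> u < 1 -> 0 <= arc_height k u /\ arc_height k u < 1.
  by clear; rewrite /arc_height => u0 u1; case: eqP => _; split; lra.
have [h0 h1] := H1 l t t0 t1; have [h0' h1'] := H1 l' t' t0' t1'.
have [le he] : level y = level y' /\ arc_height l t = arc_height l' t'.
  by clear -sm h0 h1 h0' h1'; have [||||//|[h _]|[_ h]] := nat_steps _ _ _ _ sm; lra.
have ll : (l == 1%N) = (l' == 1%N).
  by clear -he t0 t0'; move: he; rewrite /arc_height; case: eqP => _; case: eqP => _ //; lra.
have [se l0'] : arc_sector y' l' = arc_sector y l /\ ((l == 0%N) = (l' == 0%N)).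
  case: U => -[h2 h3 h4].
  - split=> //; case: eqP => e0; case: eqP => e0' //; exfalso.
    + by have := bp' e0' t0' t1'; rewrite -h4 bz // ltxx.
    + by have := bp e0 t0 t1; rewrite h4 bz' // ltxx.
  - by rewrite h3 ltxx in ap.
  - by rewrite h3 ltxx in ap'.
have lE : l = l'.
  by move: fl fl' ll l0'; rewrite /forward !inE => /or3P[]/eqP-> /or3P[]/eqP->.
split=> //; case: y y' le se {e E E' sm ab ab' U} => i j [i' j'] /= /level_inj /= ->.
by rewrite lE /arc_sector /=; case: ifP => _ => [/addIr|] ->.
Qed.

Lemma straight_line_planar : planar_drawing straight_line.
Proof.
have param u v q : nt_edge dg u v -> edge_curve straight_line u v q ->
    exists y l t, [/\ present y l, forward l, 0 <= t, t <= 1 &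
      q = arc y l t /\ ((u, v) = (y, target y l) \/ (v, u) = (y, target y l))].
  move=> uv /straight_curve h; have [y [l [pl fl E]]] := forward_edge uv.
  have {}h : segment (sl_pos y) (sl_pos (target y l)) q.
    by case: E h => -[-> ->] //; rewrite segment_sym.
  have [t [t0 t1 qe]] := arcP pl fl h.
  by exists y, l, t.
have vert u v w : nt_edge dg u v -> edge_curve straight_line u v (sl_pos w) -> w = u \/ w = v.
  move=> uv /(param _ _ _ uv)[y [l [t [pl fl t0 t1 [qe E]]]]].
  by have [h|h] := arc_endpoint pl fl t0 t1 (esym qe); case: E => -[-> ->]; rewrite h; auto.
split=> [u v uv|u v w|u v x y q uv xy ne h1 h2].
- split=> [[|i] // _|i j q ij]; last by case: j ij => [|[|]] //.
  apply/eqP => /sl_pos_inj e; have := nt_edge_irr dg u; rewrite /= in uv.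
  by rewrite {2}e => /negbT/negP; apply.
- exact: vert.
have [y1 [l1 [t1 [pl1 fl1 ta1 tb1 [q1 E1]]]]] := param _ _ _ uv h1.
have [y2 [l2 [t2 [pl2 fl2 ta2 tb2 [q2 E2]]]]] := param _ _ _ xy h2.
have done w : w \in [set u; v]%SET \/ w \in [set x; y]%SET -> q = sl_pos w ->
  exists w0, [/\ w0 \in [set u; v]%SET, w0 \in [set x; y]%SET & q = pos straight_line w0].
  move=> wi qe; exists w; split=> //; rewrite qe in h1 h2.
    by have [->|->] := vert _ _ _ uv h1; rewrite !inE eqxx ?orbT.
  by have [->|->] := vert _ _ _ xy h2; rewrite !inE eqxx ?orbT.
have [z1|z1] := eqVneq t1 0.
  apply: (done y1); last by rewrite q1 z1 arc0.
  by left; case: E1 => -[-> ->]; rewrite !inE eqxx ?orbT.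
have [n1|n1] := eqVneq t1 1.
  apply: (done (target y1 l1)); last by rewrite q1 n1 arc1.
  by left; case: E1 => -[-> ->]; rewrite !inE eqxx ?orbT.
have [z2|z2] := eqVneq t2 0.
  apply: (done y2); last by rewrite q2 z2 arc0.
  by right; case: E2 => -[-> ->]; rewrite !inE eqxx ?orbT.
have [n2|n2] := eqVneq t2 1.
  apply: (done (target y2 l2)); last by rewrite q2 n2 arc1.
  by right; case: E2 => -[-> ->]; rewrite !inE eqxx ?orbT.
have [||||yy ll] := arcs_meet fl1 fl2 _ _ _ _ (etrans (esym q1) q2).
- by rewrite lt_def z1.
- by rewrite lt_neqAle n1.
- by rewrite lt_def z2.
- by rewrite lt_neqAle n2.
case/eqP: ne; rewrite -yy -ll in E2.
by case: E1 E2 => -[-> ->] [] [-> ->]; rewrite // finset.setUC.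
Qed.

(** Coordinates in the basis [corner v.2], [corner (v.2 + 1)], for a vertex [v] of level [r]. *)
Definition label_direction (r : R) l : plane :=
  nth 0 [:: (1, 0); (- r, r); (- r, r - 1); (-1, 0); (- (2 * r), - r);
            (- (2 * r + 1), - (r + 1))] l.

Lemma level_inward v s : (v.1.+1 < L)%N -> level v = (level (inord v.1.+1, s)).+1.
Proof. by case: v => [[i iL] j] /= iL'; rewrite /level /= inordK; lia. Qed.

Lemma straight_direction v l : (l < 6)%N -> present v l ->
  let d := label_direction (level v)%:R l in
  initial_direction straight_line v (target v l) = sector v.2 d.1 d.2.
Proof.
move=> l6 pl d; rewrite /initial_direction /first_corner /= /sl_pos /d.
have E : v.2 - 1 + 1 = v.2 by rewrite subrK.
have E' : v.2 + 1 + 1 = v.2 - 1 by apply: val_inj; case: (v.2) => [[|[|[|//]]] h].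
case: l l6 pl {d} => [|[|[|[|[|[|//]]]]]] _ pl; rewrite /= /sector /= ?E ?E'.
- rewrite level_outward // -natr1 [LHS]surjective_pairing /=; congr pair; ring.
- rewrite /level /= [LHS]surjective_pairing /=.
  by case: (cornersP v.2) => -[-> -> ->] /=; congr pair; ring.
- case/andP: pl => iL _; rewrite (level_inward (v.2 + 1) iL) -natr1 [LHS]surjective_pairing /=.
  by case: (cornersP v.2) => -[-> -> ->] /=; congr pair; ring.
- rewrite (level_inward v.2 pl) -natr1 [LHS]surjective_pairing /=; congr pair; ring.
- rewrite /level /= [LHS]surjective_pairing /=.
  by case: (cornersP v.2) => -[-> -> ->] /=; congr pair; ring.
case/andP: pl => i0 _; rewrite level_outward // -natr1 [LHS]surjective_pairing /=.
by case: (cornersP v.2) => -[-> -> ->] /=; congr pair; ring.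
Qed.

Lemma cross_sector s a b a' b' :
  cross (sector s a b) (sector s a' b') = cross (a, b) (a', b').
Proof. by rewrite /sector /cross; case: (cornersP s) => -[-> -> _] /=; ring. Qed.

(** At level 1 the vectors of labels 2 and 3 would coincide; the innermost vertices, which have that
    level, have no diagonal of label 2. *)
Lemma ccw_labels r a b c : 1 <= r -> (2%N \in [:: a; b; c] -> 2 <= r) ->
  (a < b)%N -> (b < c)%N -> (c < 6)%N ->
  ccw (label_direction r a) (label_direction r b) (label_direction r c).
Proof.
move=> r1 + ab bc c6.
case: c c6 bc => [|[|[|[|[|[|//]]]]]] _; case: b ab => [|[|[|[|[|[|//]]]]]] //;
 case: a => [|[|[|[|[|[|//]]]]]] // _ _ r2;
 rewrite /label_direction /ccw /cross /=; try (have {}r2 := r2 isT); apply/or3P.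
all: solve [constructor 1; apply/andP; split; nra|constructor 2; apply/andP; split; nra
   |constructor 3; apply/andP; split; nra].
Qed.

Lemma ccw_irr (a b : plane) : ~~ ccw a a b.
Proof.
have X : cross a a = 0 by rewrite /cross; ring.
by rewrite /ccw X [cross b a]crossN oppr_gt0 ltxx andbF orbF /=; case: ltgtP.
Qed.

Lemma ccw_asym (a b c : plane) : ccw a b c -> ~~ ccw a c b.
Proof.
rewrite /ccw [cross a c]crossN [cross c b]crossN [cross b a]crossN !oppr_gt0.
by case: (ltgtP (cross a b) 0); case: (ltgtP (cross b c) 0); case: (ltgtP (cross c a) 0).
Qed.

Lemma no_ccw_between (T : eqType) (t : T) (s : seq T) (f : T -> plane) :
    uniq s ->
    (forall a b c, (a < b)%N -> (b < c)%N -> (c < size s)%N ->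
      ccw (f (nth t s a)) (f (nth t s b)) (f (nth t s c))) ->
  forall u w, u \in s -> w \in s -> ~~ ccw (f u) (f w) (f (next s u)).
Proof.
move=> us sorted u w; move=> /(nthP t)[a al <-] /(nthP t)[c cl <-].
have -> : next s (nth t s a) = if (a.+1 < size s)%N then nth t s a.+1 else nth t s 0.
  rewrite next_nth mem_nth // index_uniq //; case: s us {sorted} al cl => // x s us al cl.
  rewrite ltnS; case: ltnP => h; last by rewrite nth_default.
  exact: set_nth_default.
have irr' (x y : plane) : ~~ ccw x y y by rewrite ccw_rot ccw_irr.
case: ltnP => h.
  have [ca|ac|->] := ltngtP c a; last exact: ccw_irr.
    by apply: ccw_asym; rewrite 2!ccw_rot; exact: sorted.
  move: ac; rewrite leq_eqVlt => /orP[/eqP<-|ac]; first exact: irr'.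
  by apply: ccw_asym; exact: sorted.
have {h}e : a = (size s).-1 by lia.
have [->|c0] := posnP c; first exact: irr'.
have [ca|ca] := ltnP c a; last first.
  have -> : c = a by lia.
  exact: ccw_irr.
by apply: ccw_asym; rewrite ccw_rot; apply: sorted.
Qed.

Lemma straight_line_rotation v u w : nt_edge dg v u -> nt_edge dg v w ->
  ~~ ccw (initial_direction straight_line v u) (initial_direction straight_line v w)
         (initial_direction straight_line v (nt_rot dg v u)).
Proof.
rewrite /nt_rot permE; apply: (@no_ccw_between _ v); first exact: nbrs_uniq.
move=> a b c ab bc cl; have bl := ltn_trans bc cl; have al := ltn_trans ab bl.
have sl : sorted ltn (labels dg v) by apply: sorted_filter; [exact: ltn_trans|exact: iota_ltn_sorted].
have S : size (labels dg v) = size (nbrs dg v) by rewrite size_map.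
have lab i : (i < size (labels dg v))%N ->
    (nth 0 (labels dg v) i < 6)%N /\ present v (nth 0 (labels dg v) i).
  by move=> il; have := mem_nth 0%N il; rewrite mem_filter mem_iota => /andP[-> /= ->].
rewrite -S in al bl cl; rewrite !(nth_map 0%N) //.
have [a6 pa] := lab a al; have [b6 pb] := lab b bl; have [c6 pc] := lab c cl.
rewrite !straight_direction // /ccw !cross_sector.
have lt i j : (i < j)%N -> (j < size (labels dg v))%N ->
    (nth 0 (labels dg v) i < nth 0 (labels dg v) j)%N.
  move=> ij jl; rewrite (sorted_ltn_nth ltn_trans 0%N sl) ?inE //; exact: ltn_trans ij jl.
have := @ccw_labels (level v)%:R _ _ _ (level_ge1 v) _ (lt a b ab bl) (lt b c bc cl) c6.
rewrite /ccw -!surjective_pairing; apply.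
move=> h; rewrite ler_nat.
have /andP[iL _] : present v 2 by move: h; rewrite !inE => /or3P[]/eqP->.
by rewrite /level; lia.
Qed.

End StraightLine.

(** * The outer face of the straight-line drawing *)

Section StraightLineOuter.
Variables (R : realType) (n : nat) (dg : nat -> bool).
Local Notation L := n.+2.
Local Notation V := ('I_n.+2 * 'I_3)%type.
Local Notation plane := (R * R)%type.
Local Notation D := (straight_line R n dg).
Local Notation sl_pos := (@sl_pos R n).
Implicit Types (u v : V) (p q : plane) (s : 'I_3) (eps : R).
Local Open Scope classical_set_scope.

(* The linear form equal to 1 on the line through the corners s and s + 1. *)
Definition side s q : R := nth 0 [:: q.1 + q.2; q.2 - 2 * q.1; q.1 - 2 * q.2] s.

Lemma sideD s p q : side s (p + q) = side s p + side s q.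
Proof. by case: s => [[|[|[|//]]] h]; rewrite /side /=; ring. Qed.

Lemma sideZ s c q : side s (c *: q) = c * side s q.
Proof. by case: s => [[|[|[|//]]] h]; rewrite /side /= /GRing.scale /=; ring. Qed.

Lemma side_sector s a b :
  [/\ side s (sector s a b) = a + b, side (s + 1) (sector s a b) = b - 2 * a
    & side (s - 1) (sector s a b) = a - 2 * b].
Proof.
by case: s => [[|[|[|//]]] h]; rewrite /side /sector /=; split; ring.
Qed.

Lemma side_continuous s : continuous (side s : plane -> R).
Proof.
move=> q; have c1 : (fun z : plane => z.1) @ q --> q.1 by exact: cvg_fst.
have c2 : (fun z : plane => z.2) @ q --> q.2 by exact: cvg_snd.
case: s => [[|[|[|//]]] h]; rewrite /side /=; first exact: cvgD.
- by apply: cvgB => //; apply: cvgM => //; exact: cvg_cst.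
by apply: cvgB => //; apply: cvgM => //; exact: cvg_cst.
Qed.

Lemma side_pos_le s v : side s (sl_pos v) <= (level v)%:R.
Proof.
have r1 := level_ge1 R v; have [e1 e2 e3] := side_sector v.2 (level v)%:R 0.
have [->|->|e] := ord3_cases v.2 s; rewrite /sl_pos ?e1 ?e2; try lra.
by rewrite (_ : s = v.2 - 1) ?e3; [lra|rewrite e addrK].
Qed.

Lemma level_le v : (level v)%:R <= L%:R :> R.
Proof. by rewrite ler_nat leq_subr. Qed.

Lemma side_pos_eq s v : side s (sl_pos v) = L%:R -> v = (ord0, s) \/ v = (ord0, s + 1).
Proof.
move=> e; have r1 := level_ge1 R v; have [e1 e2 e3] := side_sector v.2 (level v)%:R 0.
have h := side_pos_le s v; have hl := level_le v.
have lv : level v = L by apply/eqP; rewrite -(eqr_nat R) eq_le hl /= -e.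
have v0 : v.1 = ord0 by apply: val_inj; move: lv; rewrite /level /=;
  have := ltn_ord v.1; lia.
move: e; rewrite /sl_pos; case: (ord3_cases v.2 s) => [->|->|vs] e.
- by left; rewrite -v0 -surjective_pairing.
- by move: e; rewrite e2 => e; exfalso; lra.
by right; rewrite -vs -v0 -surjective_pairing.
Qed.

Lemma drawn_side_le s q : drawn_set D q -> side s q <= L%:R.
Proof.
have P v : side s (sl_pos v) <= L%:R by apply: le_trans (side_pos_le s v) (level_le v).
case=> [[v ->]|[u [v [_ /straight_curve/segmentP[t [t0 t1 ->]]]]]]; first exact: P.
rewrite (_ : (_, _) = (1 - t) *: sl_pos u + t *: sl_pos v); last first.
  by rewrite [RHS]surjective_pairing /= /GRing.scale /=; congr pair; ring.
by rewrite sideD !sideZ; have := P u; have := P v; nra.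
Qed.

Lemma outer_side_drawn s q : side s q = L%:R -> (forall s', side s' q <= L%:R) -> drawn_set D q.
Proof.
move=> e h.
have [a [b qe]] : exists a b, q = sector s a b.
  rewrite /sector; case: (cornersP R s) => -[-> -> _] /=.
  - by exists q.1, q.2; rewrite [LHS]surjective_pairing; congr pair; ring.
  - by exists (q.2 - q.1), (- q.1); rewrite [LHS]surjective_pairing; congr pair; ring.
  by exists (- q.2), (q.1 - q.2); rewrite [LHS]surjective_pairing; congr pair; ring.
have := h (s + 1); have := h (s - 1); move: e; rewrite qe.
have [-> -> ->] := side_sector s a b => e ha hb.
have l0 : 0 < L%:R :> R by rewrite ltr0n.
right; exists (ord0, s), (ord0, s + 1); split.
  by apply: ring_edge; rewrite eq_sym; have [] := ord3_neq s.
apply/straight_curve/segmentP; exists (b / L%:R).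
rewrite ler_pdivlMr // mul0r ler_pdivrMr // mul1r; split; [lra|lra|].
have E : a = L%:R - b by lra.
have x : b / L%:R * L%:R = b by rewrite divfK // gt_eqF.
rewrite /sl_pos /sector /level /= subn0 E.
by move: (b / L%:R) x => c <-; congr pair; ring.
Qed.

Definition inside : set plane := [set q | forall s, side s q < L%:R].

Lemma side3 (P : 'I_3 -> Prop) : P 0 -> P 1 -> P (1 + 1) -> forall s, P s.
Proof.
move=> P1 P0 P2; case=> [[|[|[|//]]] h].
- by have -> : Ordinal h = 0 by exact: val_inj.
- by have -> : Ordinal h = 1 by exact: val_inj.
by have -> : Ordinal h = 1 + 1 by exact: val_inj.
Qed.

(** The outermost triangle is drawn, so on a component of the complement the open and the closed
    triangle cut out the same set, which is therefore open and closed in the component. *)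
Lemma inside_component p : inside p -> ~ drawn_set D p ->
  bounded_set (connected_component (~` drawn_set D) p).
Proof.
move=> ip dp; set C := connected_component _ _.
have CA : C `<=` ~` drawn_set D := @connected_component_sub _ _ _.
have CI : C `<=` inside.
  pose B := C `&` inside; suff <- : B = C by move=> q [].
  apply: (@component_connected _ (~` drawn_set D) p).
  - by exists p; split=> //; exact: connected_component_refl.
  - exists inside => //.
    have -> : inside = [set q | side 0 q < L%:R] `&` [set q | side 1 q < L%:R]
        `&` [set q | side (1 + 1) q < L%:R].
      apply/seteqP; split=> q; first by move=> h; split; [split|]; exact: h.
      by case=> [[h0 h1] h2]; exact: (@side3 (fun s => side s q < L%:R)).
    have op s : open [set q | side s q < L%:R].
      exact: (proj1 (continuousP _) (@side_continuous s) _ (@open_lt _ L%:R)).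
    by apply: openI => //; apply: openI.
  exists (\bigcap_(s in setT) [set q | side s q <= L%:R]).
    apply: closed_bigI => s _.
    exact: (proj1 (continuous_closedP _) (@side_continuous s) _ (@closed_le _ L%:R)).
  apply/seteqP; split=> q [Cq h]; split=> // s; first by move=> _; exact: ltW.
  rewrite lt_neqAle (h s I) andbT; apply/eqP => e.
  by apply: (CA q Cq); apply: outer_side_drawn e _ => s'; exact: h.
rewrite /= /bounded_near; near=> M => q /CI iq /=.
apply: (@le_trans _ _ L%:R); last by near: M; apply: nbhs_pinfty_ge; rewrite num_real.
move: (iq 0) (iq 1) (iq (1 + 1)); rewrite /side /= prod_normE ge_max => h0 h1 h2.
by rewrite !ler_norml; apply/andP; split; apply/andP; split; lra.
Unshelve. all: end_near. Qed.

(** The ray from [p] in the direction of [corner s] only increases [side s], and so never meets the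
    drawing. *)
Lemma outside_unbounded s p : L%:R < side s p -> unbounded_region D p.
Proof.
move=> sp; have nd q : L%:R < side s q -> ~ drawn_set D q.
  by move=> h /(drawn_side_le s); rewrite leNgt h.
have s1 : side s (corner R s) = 1 by case: (s) => [[|[|[|//]]] h]; rewrite /side /=; ring.
split; first exact: nd.
pose ray (t : R) : plane := p + t *: corner R s.
have sr t : side s (ray t) = side s p + t by rewrite sideD sideZ s1 mulr1.
have rayC t : 0 <= t -> connected_component (~` drawn_set D) p (ray t).
  move=> t0; apply: (@connected_component_max _ _ (ray @` `[0, +oo[)).
  - by exists 0; rewrite /= ?in_itv /= ?lexx // /ray scale0r addr0.
  - move=> y [z zi <-]; move: zi => /=; rewrite in_itv /= andbT => z0.
    by apply: nd; rewrite sr; lra.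
  - apply: connected_continuous_connected.
      by apply/connected_intervalP/interval_is_interval.
    apply: continuous_subspaceT => z; apply: cvgD; first exact: cvg_cst.
    by apply: cvgZ; [exact: cvg_id|exact: cvg_cst].
  by exists t => //=; rewrite in_itv /= t0.
move=> /ex_strict_bound_gt0[M M0 bM].
(* In the maximum norm, a point of norm less than [M] has [side s] less than [3 * M], which the
   point of the ray at this parameter contradicts. *)
have t0 : 0 <= 3 * M + `|side s p| by rewrite addr_ge0 // mulr_ge0 // ltW.
have := bM _ (rayC _ t0) => /=; rewrite prod_normE gt_max !ltr_norml.
move=> /andP[/andP[a1 a2] /andP[b1 b2]].
have := sr (3 * M + `|side s p|); have := ler_norm (- side s p); rewrite normrN.
move: a1 a2 b1 b2; set q := ray _; rewrite /side; case: (s) => [[|[|[|//]]] h] /=; lra.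
Qed.

(** For positive [a] the vector points from the corner [s + 1] to the corner [s], so its left normal
    points out of the triangle; [c] is the squared distance of these corners. *)
Lemma side_normal s : exists2 c : R, 0 < c & forall a : R,
  side s (- (sector s a (- a)).2, (sector s a (- a)).1) = c * a.
Proof.
by case: s => [[|[|[|//]]] h]; [exists 2|exists 5|exists 5] => // a;
  rewrite /side /sector /=; ring.
Qed.

Lemma straight_line_outer u v : nt_edge dg u v ->
  ((u, v) \in nt_outer n dg <-> unbounded_on_left D u v).
Proof.
move=> uv; set m := sl_pos u + 2^-1 *: (sl_pos v - sl_pos u).
set d := sl_pos v - sl_pos u; pose e : plane := (- d.2, d.1).
have sm s : side s m = (side s (sl_pos u) + side s (sl_pos v)) / 2.
  by rewrite /m sideD sideZ sideD -scaleN1r sideZ; field.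
have S eps s : side s (m + eps *: e) = side s m + eps * side s e by rewrite sideD sideZ.
have l0 : 0 < L%:R :> R by rewrite ltr0n.
have P0 s : sl_pos (ord0, s) = sector s L%:R 0 by rewrite /sl_pos /level /= subn0.
have P1 s : sl_pos (ord0, s + 1) = sector s 0 L%:R by rewrite P0 sector_next oppr0 addr0.
have dE s (a : R) : sector s a 0 - sector s 0 a = sector s a (- a).
  by rewrite /sector [LHS]surjective_pairing /=; congr pair; ring.
split.
  rewrite mem_nt_outer => /mapP[s _ [eu ev]].
  rewrite /unbounded_on_left; near=> eps.
  have eps0 : 0 < eps by near: eps; exact: nbhs_right_gt.
  apply: (@outside_unbounded s); rewrite -[X in side s X]/(m + eps *: e) S sm.
  have [c c0 E] := side_normal s.
  have -> : side s e = c * L%:R by rewrite /e /d eu ev P1 P0 dE E.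
  rewrite eu ev P1 P0.
  have [-> _ _] := side_sector s L%:R 0; have [-> _ _] := side_sector s 0 L%:R.
  by have := mulr_gt0 eps0 (mulr_gt0 c0 l0); lra.
(* For any other dart the points on the left are inside the outermost triangle: for each side,
   either the midpoint is strictly below it, or the dart runs along it counterclockwise and its left
   is the inner side. *)
move=> unb; rewrite mem_nt_outer; apply: contrapT => no.
have sl s w : side s (sl_pos w) <= L%:R by exact: le_trans (side_pos_le s w) (level_le w).
have key s : \forall eps \near (0 : R)^'+, side s (m + eps *: e) < L%:R.
  have [h|h] := ltP (side s m) L%:R.
    apply: (@near_offset _ (fun q => side s q < L%:R)).
    have /(_ [set x | x < L%:R])/=  := @side_continuous s m; apply.
    by apply: open_nbhs_nbhs; split; [exact: open_lt|].
  have hu := sl s u; have hv := sl s v; rewrite sm in h.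
  have eu : side s (sl_pos u) = L%:R by lra.
  have ev : side s (sl_pos v) = L%:R by lra.
  have [c c0 E] := side_normal s.
  have se : side s e = - (c * L%:R).
    have [ue|ue] := side_pos_eq eu; have [ve|ve] := side_pos_eq ev.
    - by have := nt_edge_irr dg u; rewrite {2}ue -ve uv.
    - rewrite -mulrN -E /e /d ue ve P1 P0.
      have -> // : sector s 0 (L%:R : R) - sector s L%:R 0 = sector s (- L%:R) (- - L%:R).
      by rewrite /sector [LHS]surjective_pairing /=; congr pair; ring.
    - by case: no; apply/mapP; exists s; rewrite ?mem_enum // ue ve.
    by have := nt_edge_irr dg u; rewrite {2}ue -ve uv.
  near=> eps; have eps0 : 0 < eps by near: eps; exact: nbhs_right_gt.
  by rewrite S se; have := mulr_gt0 eps0 (mulr_gt0 c0 l0); rewrite sm; lra.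
have [eps [[[k0 k1] k2] [nd ub]]] :=
  @filter_ex _ _ _ _ (filterI (filterI (filterI (key 0) (key 1)) (key (1 + 1))) unb).
apply: ub; apply: inside_component nd.
exact: (@side3 (fun s => side s _ < L%:R)).
Unshelve. all: end_near. Qed.

Lemma nested_triangles_planar : planar_embedding R (nested_triangles n dg).
Proof.
exists D; split; first exact: straight_line_planar.
by split=> [v u w|u v]; [exact: straight_line_rotation|exact: straight_line_outer].
Qed.

End StraightLineOuter.

(** * Lower bound on the number of bends *)

Section LowerBound.
Variables (R : realType) (n : nat) (dg : nat -> bool).
Local Notation L := n.+2.
Local Notation G := (nested_triangles n dg).
Local Notation V := ('I_n.+2 * 'I_3)%type.
Variable D : drawing R G.
Hypotheses (planar : planar_drawing D) (oct : octilinear_drawing D)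
  (emb : respects_embedding D).
Local Notation EP := (edge_points D).
Local Notation dir := (initial_direction D).
Local Notation turn u v := (polyline_turning (EP u v)).
Local Notation bend u v := (polyline_bends (EP u v)).
Implicit Types (u v w z : V) (i : 'I_n.+2) (j : 'I_3).

Lemma dir_octilinear v u : nt_edge dg v u ->
  octilinear_vector (dir v u) /\ dir v u != 0.
Proof.
move=> vu; split; last exact: initial_direction_neq0.
by have [_ +] := oct => /(_ v u 0%N vu (size_edge_points _ _ _)).
Qed.

Lemma cccw_total a b c : (a < 8)%N -> (b < 8)%N -> (c < 8)%N ->
  a != b -> b != c -> a != c -> cccw a b c || cccw a c b.
Proof.
have in8 k : (k < 8)%N -> k \in iota 0 8 by rewrite mem_iota.
move=> /in8 ha /in8 hb /in8 hc ab bc ac.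
have /allP/(_ _ ha)/allP/(_ _ hb)/allP/(_ _ hc)/implyP :
  all (fun a => all (fun b => all (fun c => [&& a != b, b != c & a != c] ==>
    (cccw a b c || cccw a c b)) (iota 0 8)) (iota 0 8)) (iota 0 8) by vm_compute.
by apply; rewrite ab bc ac.
Qed.

Lemma heading_neq v u w : nt_edge dg v u -> nt_edge dg v w -> u != w ->
  heading (dir v u) != heading (dir v w).
Proof.
move=> vu vw uw; apply/eqP => e.
have [h1 n1] := dir_octilinear vu; have [h2 n2] := dir_octilinear vw.
apply: (initial_direction_neq planar vu vw uw).
have [y1 y2 y3] := cross_heading h1 n1 h2 n2.
have [h8 _] := headingP h2 n2.
have X k : (k < 8)%N -> [/\ (0 < ccross k k) = false, (ccross k k < 0) = false & 0 < cdot k k].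
  by case: k => [|[|[|[|[|[|[|[|]]]]]]]].
have [x1 x2 x3] := X _ h8.
rewrite e x1 in y1; rewrite e x2 in y2; rewrite e x3 in y3.
by split=> //; move: y1 y2; case: ltgtP.
Qed.

(** Respecting the embedding only says that no edge lies between [u] and its successor. As the edges
    at [v] leave in distinct directions, the other cyclic order must hold. *)
Lemma rot_ccw v u w : nt_edge dg v u -> nt_edge dg v w ->
    nt_edge dg v (nt_rot dg v u) -> u != w -> nt_rot dg v u != w -> u != nt_rot dg v u ->
  ccw (dir v u) (dir v (nt_rot dg v u)) (dir v w).
Proof.
move=> vu vw vr uw rw ur.
have : ~~ ccw (dir v u) (dir v w) (dir v (nt_rot dg v u)).
  by have [h _] := emb; exact: h.
have [h1 n1] := dir_octilinear vu; have [h2 n2] := dir_octilinear vw.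
have [h3 n3] := dir_octilinear vr.
rewrite !ccw_heading // => /negbTE no.
have := cccw_total (proj1 (headingP h1 n1)) (proj1 (headingP h3 n3)) (proj1 (headingP h2 n2)).
rewrite no orbF; apply; exact: heading_neq.
Qed.

Lemma target_edge v l : (l < 6)%N -> present dg v l -> nt_edge dg v (target v l).
Proof. by move=> l6 pl; apply/nbrsP; exists l. Qed.

Lemma target_neq v l l' : (l < 6)%N -> present dg v l -> (l' < 6)%N -> present dg v l' ->
  l != l' -> target v l != target v l'.
Proof. by move=> l6 pl l6' pl'; apply: contra => /eqP/(target_inj l6 pl l6' pl')->. Qed.

Lemma label_ccw v l l' k : (l < 6)%N -> present dg v l -> (l' < 6)%N -> present dg v l' ->
    (k < 6)%N -> present dg v k -> l != l' -> l != k -> l' != k ->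
    nt_rot dg v (target v l) = target v l' ->
  ccw (dir v (target v l)) (dir v (target v l')) (dir v (target v k)).
Proof.
move=> l6 pl l6' pl' k6 pk ll' lk l'k e; rewrite -e.
by apply: rot_ccw; rewrite ?e; (exact: target_edge || exact: target_neq).
Qed.

Lemma outer_edge j : nt_edge dg ((ord0, j) : V) (ord0, j - 1).
Proof. by apply/nbrsP; exists 4%N. Qed.

Lemma outer_on_left j : unbounded_on_left D ((ord0, j) : V) ((ord0, j - 1) : V).
Proof.
have [_ out] := emb.
have e := outer_edge j.
apply/(out _ _ e); rewrite -[outer G]/(nt_outer n dg) mem_nt_outer.
by apply/mapP; exists (j - 1); rewrite ?mem_enum // /outer_dart subrK.
Qed.

(** The winding number is 0 on the outermost triangle and stays 0 inward along the column [j], as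
    long as the column avoids the given triangle. *)
Lemma column_fan u v w i j : triangle (G := G) u v w ->
    (forall i', (i' <= i)%N -> (i', j) \notin [:: u; v; w]) ->
  fan (nth 0 (boundary D u v w)) (size (boundary D u v w)).-1 (pos D (i, j)) = 0.
Proof.
move=> tri; case: i => i; elim: i => [|i IHi] iL av.
  rewrite (_ : Ordinal iL = ord0); last exact: val_inj.
  apply: (@fan_outer _ _ _ planar _ _ _ tri _ (ord0, j - 1)).
  - exact: outer_edge.
  - by apply: av.
  - exact: outer_on_left.
have iL' := ltnW iL.
rewrite -(IHi iL'); last by move=> i' h; apply: av; exact: leq_trans h _.
apply: fan_edge => //; first last.
- by apply: av => /=.
- by apply: av.
have -> : (Ordinal iL', j) = target (Ordinal iL, j) 0.
  by congr pair; apply: val_inj; rewrite /= inordK.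
exact: target_edge.
Qed.

Definition ring_turn i j : int := turn (i, j) (i, j + 1).

Lemma ring_triangle i j : triangle (G := G) (i, j) (i, j + 1) (i, j - 1).
Proof.
have [e1 e2 e3] := ord3_neq j.
by apply/and3P; split; apply: ring_edge; rewrite 1?eq_sym // eq_sym.
Qed.

(** The outside is seen from [(i, j)] along the outgoing spoke or, for triangle 0, on the left of
    the clockwise dart. *)
Lemma ring_turning i j :
  turning (nth 0 (boundary D (i, j) (i, j + 1) (i, j - 1)))
    (size (boundary D (i, j) (i, j + 1) (i, j - 1))).-1 = 2.
Proof.
have tri := ring_triangle i j.
have [i0|i0] := posnP i.
  apply: (boundary_ccw_outer planar tri); rewrite (_ : i = ord0); last exact: val_inj.
  exact: outer_on_left.
pose v : V := (i, j); have p0 : present dg v 0 by [].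
apply: (@boundary_ccw_edge _ _ _ planar _ _ _ tri (target v 0)).
- exact: target_edge.
- rewrite !inE !xpair_eqE -!(inj_eq val_inj) /= inordK; last by have := ltn_ord i; lia.
  by rewrite (_ : (i.-1 == i) = false) //; lia.
- apply: column_fan => // i'; rewrite /= inordK; last by have := ltn_ord i; lia.
  move=> h; rewrite !inE !xpair_eqE -!(inj_eq val_inj) /=.
  by rewrite (_ : (nat_of_ord i' == i) = false) //; lia.
rewrite -[(i, j - 1)]/(target v 4) -[(i, j + 1)]/(target v 1) ccw_rot.
by apply: label_ccw => //; exact: nt_rot01.
Qed.

Definition inner_bound i : int := if dg i then 5 else 2.

Lemma vertex_turn i j : (i.+1 < L)%N ->
  eighth_turn (- dir (i, j) (i, j - 1)) (dir (i, j) (i, j + 1)) <= if dg i then 1 else 2.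
Proof.
move=> iL; pose v : V := (i, j).
rewrite -[(i, j - 1)]/(target v 4) -[(i, j + 1)]/(target v 1).
have O l : (l < 6)%N -> present dg v l ->
    octilinear_vector (dir v (target v l)) /\ dir v (target v l) != 0.
  by move=> l6 pl; apply: dir_octilinear; exact: target_edge.
have [h1 n1] := O 1%N isT isT; have [h4 n4] := O 4 isT isT.
have p3 : present dg v 3 by [].
have [h3 n3] := O 3 isT p3.
case: ifP => d.
  have p2 : present dg v 2 by rewrite /= iL d.
  have [h2 n2] := O 2 isT p2.
  apply: (eighth_turn_ccw3 h4 n4 h2 n2 h3 n3 h1 n1).
    by apply: label_ccw => //; exact: nt_rot12.
  by apply: label_ccw => //; exact: nt_rot23.
apply: (eighth_turn_ccw2 h4 n4 h3 n3 h1 n1).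
by apply: label_ccw => //; apply: nt_rot13 => //=; rewrite d.
Qed.

Lemma ring_turn_sum i : (i.+1 < L)%N -> inner_bound i <= \sum_j ring_turn i j.
Proof.
move=> iL; have tri := ring_triangle i 0.
have := boundary_turning planar tri oct; rewrite ring_turning.
have a1 : (0 + 1 + 1 : 'I_3) = 0 - 1 by exact: val_inj.
have a2 : (0 - 1 + 1 : 'I_3) = 0 by exact: val_inj.
have a3 : (0 + 1 - 1 : 'I_3) = 0 by exact: val_inj.
have a4 : (0 - 1 - 1 : 'I_3) = 0 + 1 by exact: val_inj.
have := vertex_turn 0 iL; have := vertex_turn (0 + 1) iL; have := vertex_turn (0 - 1) iL.
rewrite a1 a2 a3 a4.
have -> : \sum_j ring_turn i j = ring_turn i 0 + ring_turn i (0 + 1) + ring_turn i (0 - 1).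
  rewrite !big_ord_recl big_ord0 addr0 addrA; congr (_ + _ + _);
    by congr ring_turn; exact: val_inj.
rewrite /ring_turn a1 a2 /inner_bound => h2 h1 h0 E.
have key (t1 t2 t3 x y z c : int) : x <= c -> y <= c -> z <= c ->
  4 * 2 = t1 + t2 + t3 + x + y + z -> 8 - 3 * c <= t1 + t2 + t3 by lia.
by have := key _ _ _ _ _ _ _ h1 h2 h0 E; case: (dg i).
Qed.

Lemma edge_turn_bound u v : nt_edge dg u v -> turn u v <= 3 * (bend u v)%:Z.
Proof. by move=> uv; apply: polyline_turning_bound; exact: edge_octilinear_steps. Qed.

Lemma edge_turn_sym u v : nt_edge dg u v -> turn v u = - turn u v.
Proof.
move=> uv; rewrite (edge_points_rev D uv) polyline_turning_rev //.
exact: edge_octilinear_steps.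
Qed.

Lemma edge_bend_sym u v : nt_edge dg u v -> bend v u = bend u v.
Proof. by move=> uv; rewrite (edge_points_rev D uv) polyline_bends_rev. Qed.

(** The triangular face outside the side from [(i, j)] to [(i, j + 1)] has its apex in column [j] of
    the next outer triangle; its other two edges are the spoke at [(i, j)] and the diagonal at
    [(i, j + 1)]. *)
Definition apex_bends i j : nat :=
  addn (bend (i, j) (target (i, j) 0)) (bend (i, j + 1) (target (i, j + 1) 5)).

Lemma apex_bound i j : (0 < i)%N -> dg i.-1 ->
  ring_turn i j - 1 <= 3 * (apex_bends i j)%:Z.
Proof.
move=> i0 d; have [e1 e2 e3] := ord3_neq j.
have iL := ltn_ord i; have iL' : (i.-1 < L)%N by lia.
pose a : V := (inord i.-1, j).
have v1 : a.1 = i.-1 :> nat by rewrite /= inordK.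
have wE : (i, j) = target a 3.
  by congr pair; apply: val_inj; rewrite /= !inordK; lia.
have vE : (i, j + 1) = target a 2.
  by congr pair; apply: val_inj; rewrite /= !inordK; lia.
have aE : target (i, j) 0 = a by [].
have aE' : target (i, j + 1) 5 = a by rewrite /= addrK.
have p3 : present dg a 3 by rewrite /= v1; lia.
have p2 : present dg a 2 by rewrite /= v1 d; lia.
have av : nt_edge dg a (i, j + 1) by rewrite vE; exact: target_edge.
have aw : nt_edge dg a (i, j) by rewrite wE; exact: target_edge.
have wv : nt_edge dg (i, j) (i, j + 1) by apply: ring_edge; rewrite eq_sym.
have va : nt_edge dg (i, j + 1) a by rewrite nt_edge_sym.
have wa : nt_edge dg (i, j) a by rewrite nt_edge_sym.
have tri : triangle (G := G) a (i, j + 1) (i, j).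
  by apply/and3P; split=> //; rewrite -[edge _ _]/(nt_edge dg (i, j + 1) (i, j)) nt_edge_sym.
have two : turning (nth 0 (boundary D a (i, j + 1) (i, j)))
    (size (boundary D a (i, j + 1) (i, j))).-1 = 2.
  (* The apex sees the outside along its edge to column [j - 1], the one column that the face does
     not meet. *)
  apply: (@boundary_ccw_edge _ _ _ planar _ _ _ tri (target a 4)).
  - exact: target_edge.
  - rewrite !inE !xpair_eqE (negbTE e2) [j - 1 == _]eq_sym (negbTE e3) !andbF //.
  - apply: column_fan => // i' _.
    by rewrite !inE !xpair_eqE (negbTE e2) [j - 1 == _]eq_sym (negbTE e3) !andbF.
  rewrite wE vE; apply: label_ccw => //.
  by apply: nt_rot34; rewrite v1 prednK.
have := boundary_turning planar tri oct; rewrite two.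
have B x y z : nt_edge dg x y -> nt_edge dg x z -> eighth_turn (- dir x y) (dir x z) <= 3.
  move=> xy xz; have [h1 n1] := dir_octilinear xy; have [h2 n2] := dir_octilinear xz.
  apply: eighth_turn_bound; rewrite ?oppr_eq0 //.
  by move: h1; rewrite /octilinear_vector /= !oppr_eq0 !eqr_opp.
have vw : nt_edge dg (i, j + 1) (i, j) by rewrite nt_edge_sym.
have := B _ _ _ va vw; have := B _ _ _ wv wa; have := B _ _ _ aw av.
have := edge_turn_bound av; have := edge_turn_bound wa.
rewrite (edge_turn_sym wv) (edge_bend_sym va) /apex_bends aE aE' /ring_turn.
move=> h1 h2 h3 h4 h5 E.
have key (t1 t2 t3 x y z : int) (b1 b2 : nat) : x <= 3 -> y <= 3 -> z <= 3 ->
  t1 <= 3 * b1%:Z -> t3 <= 3 * b2%:Z -> 4 * 2 = t1 + - t2 + t3 + x + y + z ->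
  t2 - 1 <= 3 * (b2 + b1)%N%:Z by clear; lia.
exact: key h5 h4 h3 h2 h1 E.
Qed.

Definition forward_bends u : nat :=
  (\sum_(l <- [:: 1; 0; 5] | present dg u l) bend u (target u l))%N.

Definition layer_bends i : nat := (\sum_j forward_bends (i, j))%N.

Definition ring_bends i j : nat := bend (i, j) (i, j + 1).

Lemma big_ord3 (W : Type) (idx : W) (op : Monoid.law idx) (f : 'I_3 -> W) :
  \big[op/idx]_j f j = op (op (f 0) (f 1)) (f (1 + 1)).
Proof.
rewrite !big_ord_recl big_ord0 Monoid.mulm1 Monoid.mulmA.
by congr (op (op _ _) _); congr f; exact: val_inj.
Qed.

Lemma ring_bends_le i : (\sum_j ring_bends i j <= layer_bends i)%N.
Proof.
apply: leq_sum => j _; rewrite /forward_bends big_cons /=.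
exact: leq_addr.
Qed.

Lemma layer_bends_apex i : (0 < i)%N -> dg i.-1 ->
  layer_bends i = addn (\sum_j ring_bends i j) (\sum_j apex_bends i j).
Proof.
move=> i0 d; rewrite /layer_bends /forward_bends /apex_bends !big_split /=.
transitivity (\sum_(j < 3) (ring_bends i j +
    (bend (i, j) (target (i, j) 0) + bend (i, j) (target (i, j) 5))))%N.
  by apply: eq_bigr => j _; rewrite !big_cons big_nil /= i0 d /= addn0.
rewrite !big_split /=; congr (_ + (_ + _)).
(* The diagonal at [(i, j + 1)] belongs to the face over the side that starts at [(i, j)]. *)
by rewrite [LHS](reindex_inj (addIr (1 : 'I_3))).
Qed.

Lemma ring_turn_bound i j : ring_turn i j <= 3 * (ring_bends i j)%:Z.
Proof.
by apply: edge_turn_bound; apply: ring_edge; have [+ _ _] := ord3_neq j; rewrite eq_sym.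
Qed.

Lemma layer_bound i : (i.+1 < L)%N ->
  ((if dg i then 2 else 1) <= layer_bends i)%N.
Proof.
move=> iL; apply: leq_trans _ (ring_bends_le i).
have -> : (\sum_j ring_bends i j)%N =
    (ring_bends i 0%R + ring_bends i 1%R + ring_bends i (1 + 1)%R)%N.
  exact: big_ord3.
have := ring_turn_sum iL; rewrite big_ord3 /inner_bound.
have key (x0 x1 x2 c : int) (b0 b1 b2 : nat) : c <= x0 + x1 + x2 ->
  x0 <= 3 * b0%:Z -> x1 <= 3 * b1%:Z -> x2 <= 3 * b2%:Z ->
  c <= 3 * (b0 + b1 + b2)%N%:Z by clear; lia.
move=> /key/(_ (ring_turn_bound i 0) (ring_turn_bound i 1) (ring_turn_bound i (1 + 1))).
by case: (dg i); clear; lia.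
Qed.

(** By integrality a side with turning t and the two other edges of its outer face have at least
    2t/3 bends: t/3 and (t - 1)/3, both rounded up, add up to that much. Total turnings 5 and 2 give
    10/3 and 4/3, that is, 4 and 2 bends. *)
Lemma layer_apex_bound i : (0 < i)%N -> dg i.-1 -> (i.+1 < L)%N ->
  ((if dg i then 4 else 2) <= layer_bends i)%N.
Proof.
move=> i0 d iL; rewrite layer_bends_apex //.
have E f : (\sum_(j < 3) f j)%N = (f 0%R + f 1%R + f (1 + 1)%R)%N by exact: big_ord3.
rewrite !E; have := ring_turn_sum iL; rewrite big_ord3 /inner_bound.
have key (x0 x1 x2 : int) (b0 b1 b2 a0 a1 a2 : nat) :
  x0 <= 3 * b0%:Z -> x1 <= 3 * b1%:Z -> x2 <= 3 * b2%:Z ->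
  x0 - 1 <= 3 * a0%:Z -> x1 - 1 <= 3 * a1%:Z -> x2 - 1 <= 3 * a2%:Z ->
  (2 <= x0 + x1 + x2 -> (2 <= (b0 + b1 + b2) + (a0 + a1 + a2))%N) /\
  (5 <= x0 + x1 + x2 -> (4 <= (b0 + b1 + b2) + (a0 + a1 + a2))%N) by clear; lia.
have [k2 k5] := key _ _ _ _ _ _ _ _ _
  (ring_turn_bound i 0) (ring_turn_bound i 1) (ring_turn_bound i (1 + 1))
  (apex_bound 0 i0 d) (apex_bound 1 i0 d) (apex_bound (1 + 1) i0 d).
by case: (dg i).
Qed.

Lemma forward_lt6 l : l \in [:: 1; 0; 5]%N -> (l < 6)%N.
Proof. by rewrite !inE => /or3P[]/eqP->. Qed.

Definition forward_dart (d : V * V) : bool :=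
  d.2 \in [seq target d.1 l | l <- [:: 1; 0; 5]%N & present dg d.1 l].

Lemma forward_dart_edge d : nt_edge dg d.1 d.2 = forward_dart d || forward_dart (d.2, d.1).
Proof.
apply/idP/orP => [/forward_edge[y [l [pl fl E]]]|].
  have yl : forward_dart (y, target y l).
    apply/mapP; exists l => //; rewrite mem_filter pl; move: fl.
    by rewrite /forward !inE => /or3P[]->; rewrite ?orbT.
  by case: E => e; [left; rewrite [d]surjective_pairing|right]; rewrite e.
have F (e : V * V) : forward_dart e -> nt_edge dg e.1 e.2.
  move=> /mapP[l]; rewrite mem_filter => /andP[pl lf] ->.
  by apply: target_edge => //; exact: forward_lt6.
by case=> /F //; rewrite nt_edge_sym.
Qed.

Lemma forward_dart_asym d : forward_dart d -> ~~ forward_dart (d.2, d.1).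
Proof.
move=> /mapP[l]; rewrite mem_filter => /andP[pl lf] E.
apply/negP => /mapP[l']; rewrite mem_filter => /andP[pl' lf'] E'.
have l6 := forward_lt6 lf; have l6' := forward_lt6 lf'.
have := target_layer l6 pl; have := target_layer l6' pl'; rewrite -E -E'.
move: pl pl' E E'; case: d => -[i j] [i' j'] /=.
move: lf lf'; rewrite !inE => /or3P[]/eqP-> /or3P[]/eqP-> //=; try (intros; lia).
move=> _ _ [_ ->] [_ e] _ _; have : j + 1 + 1 != j by case: (j) => [[|[|[|//]]] h].
by rewrite -e eqxx.
Qed.

(** [bends] counts an edge from its end of smaller rank. Reversal preserves the number of bends, so
    the edge may be counted from its forward end instead, which charges it to a triangle. *)
Lemma bends_forward : bends D = (\sum_i layer_bends i)%N.
Proof.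
pose f (d : V * V) := bend d.1 d.2.
pose low (d : V * V) := (enum_rank d.1 < enum_rank d.2)%N.
have swap_inj : injective (fun d : V * V => (d.2, d.1)) by apply: inv_inj => -[].
transitivity (\sum_(d | forward_dart d) f d)%N.
  rewrite /bends (bigID forward_dart) /= [RHS](bigID low) /=; congr addn.
    apply: eq_bigl => d; rewrite forward_dart_edge /low.
    by case: (forward_dart d); rewrite ?andbT ?andbF.
  rewrite [RHS](reindex_inj swap_inj) /=; apply: eq_big => [d|d].
    rewrite forward_dart_edge /low /=.
    have [fd|fd] := boolP (forward_dart d).
      by rewrite andbF (negbTE (forward_dart_asym fd)).
    rewrite andbT /=; have [fd'|//] := boolP (forward_dart (d.2, d.1)).
    have ne : d.1 != d.2.
      apply: contraTneq fd' => e; move: fd; rewrite [d]surjective_pairing e //.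
    by rewrite -leqNgt ltn_neqAle (inj_eq val_inj) (inj_eq enum_rank_inj) ne.
  move=> /andP[/andP[e _] _]; rewrite /f /=.
  exact/esym/edge_bend_sym.
transitivity (\sum_u \sum_(v | forward_dart (u, v)) f (u, v))%N.
  rewrite (pair_big_dep xpredT (fun u v => forward_dart (u, v)) (fun u v => f (u, v))) /=.
  by apply: eq_big => [[u v]|[u v]].
rewrite /layer_bends (pair_bigA _ (fun i j => forward_bends (i, j))) /=.
apply: eq_bigr => u _; rewrite -surjective_pairing /forward_bends.
transitivity (\sum_(v in [seq target u l | l <- [:: 1; 0; 5]%N & present dg u l]) f (u, v))%N.
  exact: eq_bigl.
rewrite -big_uniq; last first.
  rewrite map_inj_in_uniq ?filter_uniq // => l l'.
  rewrite !mem_filter => /andP[pl lf] /andP[pl' lf'].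
  exact: target_inj (forward_lt6 lf) pl (forward_lt6 lf') pl'.
by rewrite big_map big_filter.
Qed.

End LowerBound.

Lemma size_labels n (dg : nat -> bool) (v : 'I_n.+2 * 'I_3) :
  (size (labels dg v) <= 4 + dg v.1 + ((0 < v.1) && dg v.1.-1))%N.
Proof.
rewrite /labels /=; case: (0 < v.1)%N; case: (v.1.+1 < n.+2)%N; case: (dg v.1);
  by case: (dg v.1.-1).
Qed.

(** * Summation over the triangles *)

Section TotalBends.
Variables (R : realType) (n : nat) (dg : nat -> bool).
Variable D : drawing R (nested_triangles n dg).
Hypotheses (planar : planar_drawing D) (oct : octilinear_drawing D)
  (emb : respects_embedding D).

Let bound := layer_bound planar oct emb.
Let apex_bound := layer_apex_bound planar oct emb.

(** The innermost triangle is dropped, the outermost contributes [b] and each of the [n] others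
    [c]. *)
Lemma bends_layers (c : nat) (b : nat) :
    (b <= layer_bends D ord0)%N ->
    (forall i : 'I_n.+2, (0 < i)%N -> (i.+1 < n.+2)%N -> (c <= layer_bends D i)%N) ->
  (b + c * n <= bends D)%N.
Proof.
move=> h0 h; rewrite bends_forward big_ord_recl big_ord_recr /= addnA.
apply: leq_trans (leq_addr _ _); apply: leq_add => //.
rewrite -[n in (c * n)%N]card_ord mulnC -sum_nat_const; apply: leq_sum => i _.
by apply: h => //=; rewrite ltnS ltnS /bump /=.
Qed.

Lemma bends_degree4 : (forall i, ~~ dg i) -> (n.+1 <= bends D)%N.
Proof.
move=> d; have := @bends_layers 1 1; rewrite mul1n add1n; apply; first last.
  by move=> i _ iL; have := bound iL; rewrite (negbTE (d i)).
by have := @bound ord0 isT; rewrite (negbTE (d _)).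
Qed.

(** Each triangle strictly between the outermost and the innermost borders exactly one annulus with
    diagonals: the inner one if its index is even, the outer one if it is odd. The outermost has
    diagonals inside. *)
Lemma bends_degree5 : (forall i, dg i = ~~ odd i) -> (2 * n.+1 <= bends D)%N.
Proof.
move=> d; have := @bends_layers 2 2; rewrite mulnS; apply; first last.
  move=> i i0 iL; have := bound iL; have := @apex_bound i i0; rewrite !d.
  by case: (i : nat) i0 iL => //= j _ iL; case: (odd j) => //= h _; apply: h.
by have := @bound ord0 isT; rewrite d.
Qed.

Lemma bends_degree6 : (forall i, dg i) -> (4 * n + 2 <= bends D)%N.
Proof.
move=> d; have := @bends_layers 4 2; rewrite addnC; apply; first last.
  by move=> i i0 iL; have := apex_bound i0 (d _) iL; rewrite d.
by have := @bound ord0 isT; rewrite d.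
Qed.
End TotalBends.

Theorem theorem4 (R : realType) (k : nat) (hk : k = 4%N \/ k = 5%N \/ k = 6%N) :
  exists C : embedded_graph -> Prop,
    [/\ forall G : embedded_graph, C G ->
          [/\ triconnected G, planar_embedding R G & max_degree_le k G],
        forall N : nat, exists2 G : embedded_graph, C G & (N <= #|G|)%N
      & forall (G : embedded_graph) (D : drawing R G), C G ->
          planar_drawing D -> octilinear_drawing D -> respects_embedding D ->
          let n : R := #|G|%:R in
          [/\ k = 4%N -> n / 3 - 1 <= (bends D)%:R,
              k = 5%N -> 2 * n / 3 - 2 <= (bends D)%:R
            & k = 6%N -> 4 * n / 3 - 6 <= (bends D)%:R]].
Proof.
pose dg (i : nat) := if k == 4%N then false else if k == 5%N then ~~ odd i else true.
exists (fun G => exists n, G = nested_triangles n dg); split.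
- move=> _ [n ->]; split; first exact: nested_triangles_triconnected.
    exact: nested_triangles_planar.
  apply: nested_triangles_degree => v; apply: leq_trans (size_labels dg v) _.
  rewrite /dg; case: hk => [|[|]] -> /=; first by rewrite andbF.
    by case: (v.1 : nat) => //= i; case: (odd i).
  by case: (0 < v.1)%N.
- move=> N; exists (nested_triangles N dg); first by exists N.
  by rewrite card_nested_triangles; lia.
move=> G D [n GE]; move: D; rewrite {}GE => D planar oct emb N.
have {N}-> : N = 3 * (n%:R + 2) by rewrite /N card_nested_triangles natrM -[n.+2]addn2 natrD.
split=> kE.
- have d i : ~~ dg i by rewrite /dg kE.
  by have := bends_degree4 planar oct emb d; rewrite -(ler_nat R) -natr1; lra.
- have d i : dg i = ~~ odd i by rewrite /dg kE.
  by have := bends_degree5 planar oct emb d; rewrite -(ler_nat R) natrM -natr1; lra.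
have d i : dg i by rewrite /dg kE.
by have := bends_degree6 planar oct emb d; rewrite -(ler_nat R) natrD natrM; lra.
Qed.
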